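(* Let $M=(2\pi,\infty)\times S^1$ be equipped with the Riemannian metric $ds^2=g(u)(du^2+d\theta^2)$ where $$g(u)=u^{-2}(\log u)^{-1}.$$ Let $H$ be the Laplacian on $M$ (the non-negative self-adjoint operator in $L^2(M,d\mathrm{vol})$) subject either to Dirichlet or to Neumann boundary conditions. Then $e^{-Ht}$ is not ultracontractive.
   Context: $u\in(2\pi,\infty)$ and $\theta\in S^1$ are the coordinates on $M$, and $d\mathrm{vol}=g(u)\,du\,d\theta$. The Dirichlet (resp. Neumann) Laplacian is the non-negative self-adjoint operator in $L^2(M,d\mathrm{vol})$ associated with the quadratic form $Q(f)=\int_M|\nabla f|^2\,d\mathrm{vol}=\int_M\left(|\partial_uf|^2+|\partial_\theta f|^2\right)du\,d\theta$ with form domain $W^{1,2}_0(M)$ (the closure of $C_c^\infty(M)$ in $W^{1,2}(M)$), resp. $W^{1,2}(M)$. The semigroup $e^{-Ht}$ is called ultracontractive if it is bounded from $L^2$ to $L^\infty$ for all $0<t\le1$. *)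

(* Defs.v *)
From HB Require Import structures.
From mathcomp Require Import all_boot all_order all_algebra.
From mathcomp Require Import all_classical all_reals all_analysis.
From mathcomp Require Import measurable_realfun.

Set Implicit Arguments.
Unset Strict Implicit.
Unset Printing Implicit Defensive.

Import Order.TTheory GRing.Theory Num.Theory.
Import numFieldNormedType.Exports.

Local Open Scope classical_set_scope.
Local Open Scope ring_scope.

(* The circle S^1 is R / 2 pi Z.  A function on M is represented by its
   coordinate expression on R x R, of which only the values on the fundamental
   domain ]2 pi, +oo[ x [0, 2 pi[ matter: every measure below is carried by
   that set.  The identification of theta = 0 with theta = 2 pi is made by the
   test functions, which are 2 pi-periodic in theta. *)
Notation coord R := (measurableTypeR R * measurableTypeR R)%type.

Definition manifold {R : realType} : set (coord R) :=
  `]2 * pi, +oo[ `*` `[0, 2 * pi[.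

Lemma measurable_manifold {R : realType} : measurable (@manifold R).
Proof. by apply: measurableX; exact: measurable_itv. Qed.

Definition conformal_factor {R : realType} (u : R) : R := u ^- 2 * (ln u)^-1.

(* du dtheta on M *)
Notation coord_measure R :=
  (mrestr (lebesgue_measure \x lebesgue_measure)%E (@measurable_manifold R)).

(* dvol = g(u) du dtheta on M *)
Definition vol {R : realType} (A : set (coord R)) : \bar R :=
  (\int[lebesgue_measure \x lebesgue_measure]_(p in A `&` manifold)
     (conformal_factor p.1)%:E)%E.

Section vol_measure.
Context {R : realType}.

Let two_pi_gt1 : 1 < 2 * pi :> R.
Proof.
have := @pi_ge2 R; rewrite -(ler_pM2l (ltr0Sn R 1)); apply: lt_le_trans.
by rewrite -natrM ltr1n.
Qed.

Lemma conformal_factor_gt0 (u : R) : 2 * pi < u -> 0 < conformal_factor u.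
Proof.
move=> /(lt_trans two_pi_gt1) u1; have u0 := lt_trans ltr01 u1.
by rewrite mulr_gt0// invr_gt0 ?exprn_gt0// ln_gt0.
Qed.

Let measurable_conformal_factor :
  measurable_fun `]2 * pi, +oo[ (@conformal_factor R).
Proof.
apply: open_continuous_measurable_fun; first exact: interval_open.
move=> u; rewrite inE/= in_itv/= andbT => /(lt_trans two_pi_gt1) u1.
have u0 := lt_trans ltr01 u1.
apply: cvgM; apply: cvgV.
- by rewrite expf_neq0// gt_eqF.
- exact: exprn_continuous.
- by rewrite gt_eqF// ln_gt0.
- exact: continuous_ln.
Qed.

Let density (p : coord R) : \bar R := (conformal_factor p.1)%:E.
Let densityM : coord R -> \bar R := density \_ manifold.

Let measurable_density : measurable_fun setT densityM.
Proof.
apply/(measurable_restrictT _ (measurable_manifold (R := R))).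
apply/measurable_EFinP.
apply: (@measurable_comp _ _ _ _ _ _ `]2 * pi, +oo[) => //.
- by move=> _ [p [+ _] <-].
- exact: measurable_funTS.
Qed.

Let density_ge0 p : (0 <= densityM p)%E.
Proof.
rewrite /densityM patchE; case: ifPn => // /set_mem[/= + _].
by rewrite in_itv/= andbT lee_fin => /conformal_factor_gt0/ltW.
Qed.

Let volE A : vol A =
  (\int[lebesgue_measure \x lebesgue_measure]_(p in A)
     densityM p)%E.
Proof. by rewrite /vol integral_mkcondr. Qed.

Let vol0 : vol (set0 : set (coord R)) = 0%E.
Proof. by rewrite /vol set0I integral_set0. Qed.

Let vol_ge0 A : (0 <= vol (A : set (coord R)))%E.
Proof. by rewrite volE integral_ge0. Qed.

Let vol_sigma_additive : semi_sigma_additive (@vol R).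
Proof.
rewrite (_ : vol = fun A =>
    \int[lebesgue_measure \x lebesgue_measure]_(p in A)
      densityM p)%E; last by apply/funext => A; exact: volE.
exact: semi_sigma_additive_nng_induced.
Qed.

HB.instance Definition _ := isMeasure.Build _ _ _ (@vol R)
  vol0 vol_ge0 vol_sigma_additive.

End vol_measure.

(* L^2(M, dvol) and L^2(M, du dtheta): real square-integrable functions,
   to be considered up to almost everywhere equality. *)
Notation L2 R := (LfunType (@vol R) (lee1n 2)).
Notation L2coord R := (LfunType (coord_measure R) (lee1n 2)).

Section laplacian.
Context {R : realType}.
Implicit Types (f h v : L2 R) (phi : R * R -> R).

Definition L2norm f : R := fine ('N[vol]_2[EFin \o f])%E.

Definition L2inner f h : R := \int[vol]_p (f p * h p).

Definition smooth phi := forall (s : seq (R * R)) (p : R * R),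
  differentiable (foldr (fun d (psi : R * R -> R) => 'D_d psi) phi s) p.

(* C_c^oo(M); such a function vanishes near u = 2 pi, hence is extended
   smoothly by zero to u <= 2 pi *)
Definition test_function phi :=
  [/\ smooth phi,
      (forall u theta, phi (u, theta + 2 * pi) = phi (u, theta)) &
      exists a b, 2 * pi < a /\
        forall u theta, ~ (a <= u <= b) -> phi (u, theta) = 0].

Definition dir_u : R * R := (1, 0).
Definition dir_theta : R * R := (0, 1).

(* a is the distributional derivative of f on M in the direction d *)
Definition weak_derivative (d : R * R) f (a : L2coord R) :=
  forall phi, test_function phi ->
    \int[coord_measure R]_p (f p * 'D_d phi p) =
    - \int[coord_measure R]_p (a p * phi p).

Definition weak_partial (d : R * R) f : L2coord R :=
  xget 0 [set a | weak_derivative d f a].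

(* W^{1,2}(M).  As |nabla f|^2 dvol = (|f_u|^2 + |f_theta|^2) du dtheta, the
   partial derivatives are required to lie in L^2(M, du dtheta). *)
Definition W12 : set (L2 R) :=
  [set f | (exists a, weak_derivative dir_u f a) /\
           (exists a, weak_derivative dir_theta f a)].

(* Q(f) = energy f f *)
Definition energy f h : R :=
  \int[coord_measure R]_p
    (weak_partial dir_u f p * weak_partial dir_u h p +
     weak_partial dir_theta f p * weak_partial dir_theta h p).

Definition W12norm_sq f : R := L2norm f ^+ 2 + energy f f.

Definition W12_0 : set (L2 R) :=
  [set f | W12 f /\ forall e, 0 < e ->
     exists phi : L2 R, test_function phi /\ W12norm_sq (f - phi) < e].

End laplacian.

Variant boundary_condition := Dirichlet | Neumann.

Definition form_domain {R : realType} (bc : boundary_condition) : set (L2 R) :=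
  match bc with Dirichlet => W12_0 | Neumann => W12 end.

(* Graph of the operator H associated with the closed form (Q, form_domain bc):
   f is in the domain of H and H f = h. *)
Definition laplacian {R : realType} (bc : boundary_condition) (f h : L2 R) :=
  form_domain bc f /\
  forall v : L2 R, form_domain bc v -> energy f v = L2inner h v.

Definition L2cvg0 {R : realType} (F : R -> L2 R) :=
  L2norm (F t) @[t --> 0^'+] --> (0 : R).

(* T t = e^{-Ht} for t >= 0: T is the strongly continuous contraction semigroup
   on L^2(M, dvol) whose generator is -H, H being given by its graph. *)
Record semigroup_generated_by_opp {R : realType} (H : L2 R -> L2 R -> Prop)
    (T : R -> L2 R -> L2 R) : Prop := {
  semigroup_linear : forall t (a : R) (f h : L2 R), 0 <= t ->
    T t (a *: f + h) = a *: T t f + T t h %[ae vol] ;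
  semigroup_contraction : forall t (f : L2 R), 0 <= t ->
    L2norm (T t f) <= L2norm f ;
  semigroup_0 : forall f : L2 R, T 0 f = f %[ae vol] ;
  semigroup_add : forall s t (f : L2 R), 0 <= s -> 0 <= t ->
    T (s + t) f = T s (T t f) %[ae vol] ;
  semigroup_continuous : forall f : L2 R, L2cvg0 (fun t => T t f - f) ;
  semigroup_generator : forall f h : L2 R,
    H f h <-> L2cvg0 (fun t => t^-1 *: (T t f - f) + h)
}.

Definition ultracontractive {R : realType} (T : R -> L2 R -> L2 R) :=
  forall t, 0 < t <= 1 -> exists C : R, forall f : L2 R,
    ('N[vol]_+oo[EFin \o T t f] <= (C * L2norm f)%:E)%E.

(* Main.v *)
(* Ultracontractivity fails on radial bumps phi supported in r <= u <= 2 r, where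
   r = exp(L) / 2 tends to infinity.  The energy of phi is O(1 / r), while its
   squared norm is at least c / (r L), because dvol = du dtheta / (u^2 log u);
   hence the Rayleigh quotient E of phi is only O(L).  For a symmetric semigroup,
   t |-> <T_t phi, phi> is log-convex, so <T_t phi, phi> >= exp(- 2 t E) |phi|^2,
   which is at least exp(- L / 4) |phi|^2 for a small t that does not depend on L.
   If T_t were bounded from L^2 to L^oo, then <T_t phi, phi> would be at most
   C |phi| |phi|_1 = O(exp(- L) |phi|), a contradiction as L tends to infinity. *)
From HB Require Import structures.
Require Import Defs.
From mathcomp Require Import all_boot all_order all_algebra.
From mathcomp Require Import all_classical all_reals all_analysis.
From mathcomp Require Import measurable_realfun ess_sup_inf ring lra.

Set Implicit Arguments.
Unset Strict Implicit.
Unset Printing Implicit Defensive.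

Import Order.TTheory GRing.Theory Num.Theory.
Import numFieldNormedType.Exports.

Local Open Scope classical_set_scope.
Local Open Scope ring_scope.

(** * Inner product calculus on L^2(M, dvol) *)

(** Nothing is known of [T] beyond the generator axioms: neither its symmetry nor a spectral
    calculus is given. Log-convexity is therefore derived only along the orbit of one [f] in the
    domain of H, by discretising time, and only at midpoints; the derivative at time 0 followed by
    repeated doubling replaces Jensen's inequality for the spectral measure. The logarithm in g
    makes E grow only like log r, so the passage to time t costs a power of r whose exponent is
    proportional to t. The ratio |phi| / |phi|_1 gains at least r^(1/2) up to a logarithm, and t is
    chosen so that the cost is about r^(-1/4). The energy is defined through an arbitrary choice of
    weak derivatives, so much of the analysis serves to show that these are unique almost everywhere
    and, for test functions, equal to the classical ones. Test functions then lie in the domain of H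
    for either boundary condition, because they vanish near u = 2 pi. *)

Section L2_calculus.
Context {R : realType}.
Implicit Types (f g h : L2 R) (a : R).

Lemma L2inner_integrable f h :
  (@vol R).-integrable setT (EFin \o (fun p => f p * h p)).
Proof. by apply/Lfun1_integrable/Lfun2_mul_Lfun1; exact: LfunP. Qed.

Lemma L2innerC f h : L2inner f h = L2inner h f.
Proof. by apply: eq_Rintegral => p _; rewrite mulrC. Qed.

Lemma L2innerDl f g h : L2inner (f + g) h = L2inner f h + L2inner g h.
Proof.
rewrite /L2inner -RintegralD//; [|exact: L2inner_integrable..].
by apply: eq_Rintegral => p _; rewrite -mulrDl.
Qed.

Lemma L2innerZl a f h : L2inner (a *: f) h = a * L2inner f h.
Proof.
rewrite /L2inner -RintegralZl//; last exact: L2inner_integrable.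
by apply: eq_Rintegral => p _; rewrite mulrA.
Qed.

Lemma L2innerNl f h : L2inner (- f) h = - L2inner f h.
Proof. by rewrite -scaleN1r L2innerZl mulN1r. Qed.

Lemma L2norm_sqr f : L2norm f ^+ 2 = L2inner f f.
Proof.
apply: EFin_inj; rewrite /L2inner /Rintegral fineK; last first.
  by apply: integrable_fin_num => //; exact: L2inner_integrable.
rewrite -powR_mulrn; last by rewrite fine_ge0// Lnorm_ge0.
rewrite -poweR_EFin /L2norm finite_norm_fine poweR_Lnorm//.
by apply: eq_integral => p _; rewrite /= powR_mulrn// -normrX ger0_norm// sqr_ge0.
Qed.

Lemma L2norm_ge0 f : 0 <= L2norm f.
Proof. by rewrite fine_ge0// Lnorm_ge0. Qed.

(** The semigroup laws hold only almost everywhere; they enter inner products and norms through this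
    lemma and the next one. *)
Lemma L2inner_ae f g h : f = g %[ae vol] -> L2inner f h = L2inner g h.
Proof.
move=> fg; rewrite /L2inner /Rintegral; congr fine.
apply: ae_eq_integral => //=.
- by have /measurable_int := L2inner_integrable f h.
- by have /measurable_int := L2inner_integrable g h.
- by apply: filterS fg => p /= /(_ I) -> _.
Qed.

Lemma L2norm_ae f g : f = g %[ae vol] -> L2norm f = L2norm g.
Proof.
move=> fg; apply/eqP; rewrite -(@eqrXn2 _ 2%N)// ?L2norm_ge0//; apply/eqP.
by rewrite !L2norm_sqr (L2inner_ae _ fg) L2innerC (L2inner_ae _ fg).
Qed.

Lemma L2_cauchy_schwarz f h : `|L2inner f h| <= L2norm f * L2norm h.
Proof.
rewrite (le_trans (le_normr_Rintegral _ (L2inner_integrable f h)))//.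
rewrite -lee_fin EFinM /L2norm !finite_norm_fine.
have := @hoelder _ _ R (@vol R) f h 2 2; rewrite Lnorm1 => H.
apply: le_trans (H _ _ _ _ _) => //; last by rewrite [RHS]splitr !div1r.
rewrite /Rintegral fineK//; apply: integrable_fin_num => //.
by have /integrable_norm := L2inner_integrable f h.
Qed.

End L2_calculus.

(** * Lower bound for symmetric semigroups *)

Section semigroup.
Context {R : realType} (H : L2 R -> L2 R -> Prop) (T : R -> L2 R -> L2 R).
Hypothesis TH : semigroup_generated_by_opp H T.
Hypothesis H_symmetric : forall f h f' h' : L2 R,
  H f h -> H f' h' -> L2inner h f' = L2inner f h'.

Lemma semigroupZ (t a : R) (f : L2 R) : 0 <= t ->
  T t (a *: f) = a *: T t f %[ae vol].
Proof.
move=> t0.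
have T0 : T t 0 = 0 %[ae vol].
  have := semigroup_linear TH 1 0 0 t0; rewrite scale1r addr0 scale1r.
  apply: filterS => p /(_ I)/= T00 _; apply: (@addIr _ (T t 0 p)).
  by rewrite -[LHS]T00; symmetry; exact: add0r.
have := semigroup_linear TH a f 0 t0; rewrite addr0.
apply: filterS2 T0 => p /(_ I) T0p /(_ I) -> _.
by rewrite -[LHS]/((a *: T t f) p + T t 0 p) T0p; exact: addr0.
Qed.

Lemma semigroupD (t : R) (f h : L2 R) : 0 <= t ->
  T t (f + h) = T t f + T t h %[ae vol].
Proof.
by move=> t0; have := semigroup_linear TH 1 f h t0; rewrite !scale1r.
Qed.

(** The size of the remainder in T_s f = f - s h + o(s), divided by s. It tends to 0 at 0+ exactly
    when H f = h. *)
Definition generator_error (f h : L2 R) (s : R) : R :=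
  L2norm (s^-1 *: (T s f - f) + h).

(** T_t commutes with T_s, so the error vector at T_t f is T_t applied to the one at f, and T_t is a
    contraction. The error is thus uniform along the orbit, which lets many small steps be
    summed. *)
Lemma generator_error_orbit f h (s t : R) : 0 <= s -> 0 <= t ->
  generator_error (T t f) (T t h) s <= generator_error f h s.
Proof.
move=> s0 t0; rewrite /generator_error.
rewrite (_ : L2norm _ = L2norm (T t (s^-1 *: (T s f - f) + h))).
  exact: (semigroup_contraction TH).
apply: L2norm_ae.
have E1 := semigroupD (s^-1 *: (T s f - f)) h t0.
have E2 := semigroupZ s^-1 (T s f - f) t0.
have E3 := semigroupD (T s f) (- f) t0.
have E4 := semigroupZ (-1) f t0; rewrite scaleN1r in E4.
have E5 := semigroup_add TH f s0 t0; have E6 := semigroup_add TH f t0 s0.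
rewrite addrC in E6.
apply: (filterS _ (filterI E1 (filterI E2 (filterI E3 (filterI E4 (filterI E5 E6)))))).
move=> p [] /(_ I) e1 [] /(_ I) e2 [] /(_ I) e3 [] /(_ I) e4 [] /(_ I) e5 /(_ I) e6 _.
apply: esym; rewrite e1 -[LHS]/(T t (s^-1 *: (T s f - f)) p + T t h p) e2.
rewrite -[X in X + _]/(s^-1 * T t (T s f - f) p) e3.
rewrite -[X in _ * X]/(T t (T s f) p + T t (- f) p) e4 -e6 e5.
rewrite -[X in _ * (_ + X)]/(-1 * T t f p) mulN1r.
by [].
Qed.

Lemma generator_orbit f h (t : R) : 0 <= t -> H f h -> H (T t f) (T t h).
Proof.
move=> t0 /(semigroup_generator TH) fh; apply/(semigroup_generator TH).
apply: (squeeze_cvgr _ (cvg_cst 0) fh); near=> s; rewrite L2norm_ge0/=.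
exact: generator_error_orbit.
Unshelve. all: by end_near. Qed.

Lemma semigroup_expansion f h (s : R) : s != 0 ->
  T s f = f - s *: h + s *: (s^-1 *: (T s f - f) + h).
Proof.
by move=> s0; rewrite scalerDr scalerA divff// scale1r addrCA addrNK addrC subrKC.
Qed.

(* [s |-> <T_{t-s} f, T_s f>] has derivative
   [- <T_{t-s} f, T_s h> + <T_{t-s} h, T_s f> = 0]; here is its increment. *)
Lemma semigroup_shift_error f h (s a b : R) : H f h -> 0 < s -> 0 <= a -> 0 <= b ->
  `|L2inner (T a f) (T (s + b) f) - L2inner (T (s + a) f) (T b f)| <=
  2 * s * generator_error f h s * L2norm f.
Proof.
move=> fh s0 a0 b0.
have sn0 : s != 0 by rewrite gt_eqF.
have Tf c : 0 <= c -> L2norm (T c f) <= L2norm f by exact: (semigroup_contraction TH).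
rewrite L2innerC (L2inner_ae _ (semigroup_add TH f (ltW s0) b0)).
rewrite (L2inner_ae _ (semigroup_add TH f (ltW s0) a0)).
have sym := H_symmetric (generator_orbit a0 fh) (generator_orbit b0 fh).
rewrite (semigroup_expansion (T a f) (T a h) sn0).
rewrite (semigroup_expansion (T b f) (T b h) sn0).
rewrite !L2innerDl !L2innerNl !L2innerZl sym (L2innerC (T b f)).
rewrite (L2innerC (T b h)).
set ea := _ + T a h; set eb := _ + T b h.
rewrite opprD addrACA subrr add0r -mulrBr normrM gtr0_norm//.
rewrite (_ : 2 * s * _ * _ = s * (2 * (generator_error f h s * L2norm f)));
  last by ring.
rewrite ler_pM2l// (le_trans (ler_normB _ _))// mulr2n mulrDl !mul1r lerD//.
- rewrite (le_trans (L2_cauchy_schwarz _ _))// ler_pM ?L2norm_ge0 ?Tf//.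
  by apply: generator_error_orbit; rewrite // ltW.
- rewrite (le_trans (L2_cauchy_schwarz _ _))// ler_pM ?L2norm_ge0 ?Tf//.
  by apply: generator_error_orbit; rewrite // ltW.
Qed.

(** Time t is moved from one factor to the other in n steps of length t / n. Each step costs 2 (t /
    n) |f| times the error at t / n, so the total is 2 t |f| times an error that tends to 0. *)
Lemma semigroup_orbit_symmetric f h (t : R) : H f h -> 0 < t ->
  L2inner (T (t + t) f) (T 0 f) = L2inner (T t f) (T t f).
Proof.
move=> fh t0; apply/eqP; rewrite -subr_eq0 -normr_le0.
have step (n : nat) (s : R) : 0 < s ->
    forall k, (k <= n)%N -> `|L2inner (T (s * n%:R + s * n%:R) f) (T 0 f) -
      L2inner (T (s * n%:R + s * (n - k)%:R) f) (T (s * k%:R) f)| <=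
    k%:R * (2 * s * generator_error f h s * L2norm f).
  move=> s0; elim=> [|k IH] kn; first by rewrite subn0 mulr0 mul0r subrr normr0.
  rewrite -natr1 (mulrDl k%:R) mul1r.
  set A := L2inner _ _; set C := L2inner _ _.
  set B := L2inner (T (s * n%:R + s * (n - k)%:R) f) (T (s * k%:R) f).
  rewrite [X in `|X|](_ : _ = (A - B) + (B - C)); last by rewrite addrA subrK.
  rewrite (le_trans (ler_normD _ _))// lerD ?IH// 1?ltnW//.
  rewrite distrC /B /C.
  have -> : s * (k%:R + 1) = s + s * k%:R :> R by ring.
  have -> : s * n%:R + s * (n - k)%:R = s + (s * n%:R + s * (n - k.+1)%:R).
    by rewrite -(subnSK kn) -natr1; ring.
  apply: semigroup_shift_error => //.
    by rewrite addr_ge0// mulr_ge0// ltW.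
  by rewrite mulr_ge0// ltW.
have bound (n : nat) : (0 < n)%N ->
   `|L2inner (T (t + t) f) (T 0 f) - L2inner (T t f) (T t f)| <=
   2 * t * L2norm f * generator_error f h (t / n%:R).
  move=> n0; have s0 : 0 < t / n%:R by rewrite divr_gt0// ltr0n.
  have := step n _ s0 n (leqnn n); rewrite subnn mulr0 addr0 divfK ?pnatr_eq0 -?lt0n//.
  move=> /le_trans; apply; rewrite le_eqVlt; apply/orP; left; apply/eqP.
  set e := generator_error _ _ _; field.
  by rewrite pnatr_eq0 -lt0n.
have cv : 2 * t * L2norm f * generator_error f h (t / n.+1%:R) @[n --> \oo] --> (0 : R).
  rewrite -[X in _ --> X](mulr0 (2 * t * L2norm f)); apply: cvgMr.
  have /(semigroup_generator TH) := fh; rewrite /L2cvg0 => /cvg_at_rightP; apply; split.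
    by move=> n; rewrite divr_gt0// ltr0n.
  rewrite -[0](mulr0 t); apply: cvgMr; exact: cvg_harmonic.
apply: (ler_cvg_to (cvg_cst _) cv) => //.
by near=> n; exact: bound.
Unshelve. all: by end_near. Qed.

(** By Cauchy-Schwarz the left side is at most |T_t f|^2 |f|^2, and |T_t f|^2 = <T_{2t} f, f> by
    symmetry along the orbit. *)
Lemma semigroup_log_convex f h (t : R) : H f h -> 0 < t ->
  L2inner (T t f) f ^+ 2 <= L2inner (T (t + t) f) f * L2inner f f.
Proof.
move=> fh t0.
have := semigroup_orbit_symmetric fh t0.
rewrite L2innerC (L2inner_ae _ (semigroup_0 TH f)) L2innerC => ->.
rewrite -!L2norm_sqr -exprMn -real_normK ?num_real// lerXn2r// ?nnegrE//.
- by rewrite mulr_ge0// L2norm_ge0.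
- exact: L2_cauchy_schwarz.
Qed.

(** At s = 0 the derivative of <T_s f, f> is - <h, f>, which is strictly above - E |f|^2; the strict
    gap absorbs the error term. *)
Lemma semigroup_short_time f h (E : R) : H f h ->
  L2inner h f < E * L2inner f f ->
  \forall s \near 0^'+, (1 - s * E) * L2inner f f <= L2inner (T s f) f.
Proof.
move=> fh hE.
have cv : generator_error f h s * L2norm f @[s --> 0^'+] --> (0 : R).
  rewrite -[X in _ --> X](mul0r (L2norm f)); apply: cvgMl.
  exact: (semigroup_generator TH f h).1.
have e0 : 0 < E * L2inner f f - L2inner h f by rewrite subr_gt0.
near=> s.
have s0 : 0 < s by [].
rewrite (semigroup_expansion f h (lt0r_neq0 s0)).
rewrite !L2innerDl L2innerNl !L2innerZl.
set e := _ + h.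
rewrite -subr_ge0 (_ : _ - _ = s * (E * L2inner f f - L2inner h f + L2inner e f));
  last by ring.
rewrite mulr_ge0 ?(ltW s0)// -lerBlDr sub0r.
have := L2_cauchy_schwarz e f; rewrite ler_norml => /andP[+ _].
rewrite lerNl => /le_trans; apply.
have : `|generator_error f h s * L2norm f - 0| < E * L2inner f f - L2inner h f.
  near: s; move/cvgrPdist_lt : cv => /(_ _ e0).
  by apply: filterS => s; rewrite distrC.
by rewrite subr0 => /(le_lt_trans (ler_norm _))/ltW.
Unshelve. all: by end_near. Qed.

(** Follows from exp(2y) >= 1 + 2y and (1 + 2y)(1 - y) >= 1. The factor 2 is the price for turning
    the linear short-time bound into an exponential. *)
Lemma expRN2_le (y : R) : 0 <= y <= 2^-1 -> expR (- (2 * y)) <= 1 - y.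
Proof.
move=> /andP[y0 y1]; rewrite expRN -[leRHS]invrK lef_pV2 ?posrE ?expR_gt0 ?invr_gt0//;
  last lra.
apply: le_trans (expR_ge1Dx _).
rewrite -[leLHS]mul1r ler_pdivrMr; last lra.
nra.
Qed.

(** The short-time bound is applied at time t / 2^k and carried to time t by k doublings, each of
    which squares the ratio <T_s f, f> / |f|^2. *)
Lemma semigroup_lower_bound f h (E t : R) : H f h -> 0 < E -> 0 < t ->
  L2inner h f < E * L2inner f f ->
  expR (- (2 * (t * E))) * L2inner f f <= L2inner (T t f) f.
Proof.
move=> fh E0 t0 hE; set N := L2inner f f.
have N0 : 0 <= N by rewrite /N -L2norm_sqr sqr_ge0.
have [N00|Nn0] := eqVneq N 0.
  (* If f has norm zero, the strict hypothesis on E reads 0 < 0. *)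
  move: hE; rewrite -/N N00 !mulr0; have := L2_cauchy_schwarz h f.
  have := L2_cauchy_schwarz (T t f) f.
  have -> : L2norm f = 0.
    by apply/eqP; rewrite -(@eqrXn2 _ 2%N)// ?L2norm_ge0// L2norm_sqr -/N N00 expr0n.
  by rewrite !mulr0 !normr_le0 => /eqP -> /eqP ->; rewrite ltxx.
have {N0 Nn0}N0 : 0 < N by rewrite lt_neqAle eq_sym Nn0.
have doubling k (s y : R) : 0 < s -> expR (- y) * N <= L2inner (T s f) f ->
    expR (- (2 ^+ k * y)) * N <= L2inner (T (2 ^+ k * s) f) f.
  move=> s0 sy; elim: k => [|k IH]; first by rewrite expr0 !mul1r.
  have s20 : 0 < 2 ^+ k * s by rewrite mulr_gt0// exprn_gt0.
  have := semigroup_log_convex fh s20; rewrite -/N => lc.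
  rewrite (_ : 2 ^+ k.+1 * s = 2 ^+ k * s + 2 ^+ k * s); last by rewrite exprS; ring.
  rewrite -(ler_pM2r N0) (le_trans _ lc)//.
  have -> : expR (- (2 ^+ k.+1 * y)) = expR (- (2 ^+ k * y)) ^+ 2.
    by rewrite -expRM_natl exprS; congr expR; ring.
  rewrite -mulrA -expr2 -exprMn lerXn2r// nnegrE.
    by rewrite mulr_ge0 ?expR_ge0// ltW.
  by rewrite (le_trans _ IH)// mulr_ge0 ?expR_ge0// ltW.
have cv0 : t / 2 ^+ k @[k --> \oo] --> (0 : R).
  rewrite -[0](mulr0 t); apply: cvgMr.
  under eq_fun do rewrite -exprVn.
  by apply: cvg_expr; rewrite ger0_norm ?invr_ge0// invf_lt1// ltr1n.
have [e /= e0 eP] := semigroup_short_time fh hE.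
(* The first bound puts t / 2^k in the range of the short-time estimate, the second one in the range
   of [expRN2_le]. *)
have [k [ke kE]] : exists k, t / 2 ^+ k < e /\ t / 2 ^+ k < (2 * E)^-1.
  have m0 : 0 < Num.min e (2 * E)^-1 by rewrite lt_min e0 invr_gt0 mulr_gt0.
  have [k _ /(_ k (leqnn k))] := cvgr_lt _ cv0 _ m0.
  by rewrite /= lt_min => /andP[]; exists k.
have s0 : 0 < t / 2 ^+ k by rewrite divr_gt0// exprn_gt0.
have := doubling k (t / 2 ^+ k) (2 * (t / 2 ^+ k * E)) s0.
rewrite (_ : 2 ^+ k * (t / 2 ^+ k) = t); last by field; rewrite expf_neq0.
rewrite (_ : 2 ^+ k * (2 * _) = 2 * (t * E)); last by field; rewrite expf_neq0.
apply; apply: (@le_trans _ _ ((1 - t / 2 ^+ k * E) * N)).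
  rewrite ler_pM2r// expRN2_le// mulr_ge0 ?ltW//=.
  by move: kE; rewrite invfM ltr_pdivlMr.
by apply: eP => //=; rewrite sub0r normrN gtr0_norm.
Qed.

End semigroup.

(** * A stock of smooth functions *)

Section flat_function.
Context {R : realType}.

(** For k = 0 this is the classical smooth function exp(-1/x) extended by zero. The index k makes
    the linear span of the family closed under differentiation. *)
Definition flat (k : nat) (x : R) : R :=
  if 0 < x then x^-1 ^+ k * expR (- x^-1) else 0.

Lemma flat_gt0E k (x : R) : 0 < x -> flat k x = x^-1 ^+ k * expR (- x^-1).
Proof. by rewrite /flat => ->. Qed.

Lemma flat_le0E k (x : R) : x <= 0 -> flat k x = 0.
Proof. by rewrite /flat leNgt => /negbTE ->. Qed.

Lemma flat_ge0 k (x : R) : 0 <= flat k x.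
Proof.
rewrite /flat; case: ifPn => // x0.
by rewrite mulr_ge0 ?expR_ge0// exprn_ge0// invr_ge0 ltW.
Qed.

(** With y = 1/x this is y^k / k! <= exp(y). It supplies the bound 1 on cut-offs (k = 0) and the
    bound 2 on the derivative of the bump (k = 2). *)
Lemma flat_le k (x : R) : flat k x <= k`!%:R.
Proof.
rewrite /flat; case: ifPn => // x0.
have y0 : 0 <= x^-1 by rewrite invr_ge0 ltW.
rewrite expRN ler_pdivrMr ?expR_gt0//.
case: k => [|k]; first by rewrite expr0 fact0 mul1r (le_trans _ (expR_ge1Dx _))// lerDl.
have := expR_ge1Dxn k y0; have f0 : 0 < k.+1`!%:R :> R by rewrite ltr0n fact_gt0.
rewrite -(ler_pM2l f0) mulrDr mulr1 mulrCA divff ?gt_eqF// mulr1.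
by apply: le_trans; rewrite lerDr ltW.
Qed.

Lemma flat_shift k (x : R) : x * flat k.+1 x = flat k x.
Proof.
rewrite /flat; case: ifPn => x0; last by rewrite mulr0.
by rewrite exprS !mulrA divff ?gt_eqF// mul1r.
Qed.

Lemma is_derive_flat k (x : R) :
  is_derive x 1 (flat k) (flat k.+2 x - k%:R * flat k.+1 x).
Proof.
have [x0|x0|->] := ltgtP x 0.
- rewrite !flat_le0E ?(ltW x0)// mulr0 subr0.
  apply: (@near_eq_is_derive _ _ _ (cst 0)) => //.
  by near=> z; rewrite flat_le0E// ltW//; near: z; exact: lt_nbhsl.
- apply: (@near_eq_is_derive _ R R (fun x : R => x^-1 ^+ k * expR (- x^-1))) => //.
    by near=> z; rewrite flat_gt0E//; near: z; exact: lt_nbhsr.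
  have xn0 : x != 0 by rewrite gt_eqF.
  have dV : is_derive x 1 (fun x : R => x^-1) (- x ^- 2).
    apply: DeriveDef; first exact: derivableV.
    by rewrite deriveV//= derive_id /GRing.scale/= mulr1.
  have dN : is_derive x 1 (fun x : R => - x^-1) (x ^- 2).
    by rewrite -[X in is_derive _ _ _ X]opprK; exact: is_deriveN.
  have dE : is_derive x 1 (fun x : R => expR (- x^-1)) (expR (- x^-1) * x ^- 2).
    exact: (@is_derive1_comp _ expR (fun x : R => - x^-1)).
  have dX : is_derive x 1 (fun x : R => x^-1 ^+ k)
      (k%:R * x^-1 ^+ k.-1 * - x ^- 2).
    by have := @is_deriveX _ _ (fun x : R => x^-1) k _ _ _ dV; rewrite exprfctE.
  apply: is_derive_eq (is_deriveM dX dE) _.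
  rewrite !flat_gt0E// /GRing.scale/=.
  case: (k) => [|n] /=; first by rewrite mulr0n; field.
  by rewrite !exprS; field.
- rewrite !flat_le0E// mulr0 subr0.
  suff : (fun h => h^-1 *: (flat k (h *: 1 + 0) - flat k 0)) @ (0 : R)^' --> (0 : R).
    move=> c; apply: DeriveDef; last by rewrite /derive; exact: cvg_lim.
    by apply/cvg_ex; exists 0.
  have c0 : (fun h : R => k.+2`!%:R * `|h|) @ (0 : R)^' --> (0 : R).
    rewrite -[X in _ --> X](mulr0 (k.+2`!%:R)); apply: cvgMr.
    rewrite -[X in _ --> X](@normr0 _ R); apply: cvg_norm.
    apply: cvg_within_filter; exact: cvg_id.
  apply: norm_cvg0; apply: (squeeze_cvgr _ (cvg_cst 0) c0).
  near=> h; rewrite normr_ge0/=.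
  have hn0 : h != 0 by near: h; exact: nbhs_dnbhs_neq.
  rewrite addr0 /GRing.scale/= mulr1 (flat_le0E _ (lexx 0)) subr0.
  (* Two shifts turn the difference quotient into flat k h / h = h * flat k.+2 h, which is
     O(|h|). *)
  rewrite -flat_shift mulKf// -flat_shift normrM mulrC ler_wpM2r//.
  by rewrite ger0_norm ?flat_ge0// flat_le.
Unshelve. all: by end_near. Qed.

End flat_function.

Section smooth_class.
Context {R : realType}.
Implicit Types F G : R * R -> R.

Lemma linear_form_differentiable (f : R * R -> R) p :
  (forall a q r, f (a *: q + r) = a * f q + f r) -> continuous f ->
  differentiable f p /\ forall d, 'D_d f p = f d.
Proof.
move=> lf cf.
pose g : {linear (R * R)%type -> R} :=
  HB.pack f (GRing.isLinear.Build R (R * R)%type R *%R f lf).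
have dg : differentiable g p by exact: linear_differentiable.
by split=> // d; rewrite -[f]/(g : _ -> _) deriveE// diff_lin.
Qed.

Lemma differentiable_fst (p : R * R) :
  differentiable (@fst R R) p /\ forall d, 'D_d (@fst R R) p = d.1.
Proof. by apply: linear_form_differentiable => // q; exact: cvg_fst. Qed.

Lemma differentiable_snd (p : R * R) :
  differentiable (@snd R R) p /\ forall d, 'D_d (@snd R R) p = d.2.
Proof. by apply: linear_form_differentiable => // q; exact: cvg_snd. Qed.

(* A class stable under all directional derivatives, so that its members are
   smooth; compositions with flat provide cut-offs. *)
Inductive elementary : (R * R -> R) -> Prop :=
| elem_cst c : elementary (fun=> c)
| elem_fst : elementary fst
| elem_snd : elementary snd
| elem_add F G : elementary F -> elementary G -> elementary (fun p => F p + G p)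
| elem_mul F G : elementary F -> elementary G -> elementary (fun p => F p * G p)
| elem_sin F : elementary F -> elementary (fun p => sin (F p))
| elem_cos F : elementary F -> elementary (fun p => cos (F p))
| elem_flat k F : elementary F -> elementary (fun p => flat k (F p)).

Lemma elementary_opp F : elementary F -> elementary (fun p => - F p).
Proof.
move=> eF; rewrite (_ : (fun p => _) = fun p => (-1) * F p).
  exact: elem_mul (elem_cst _) eF.
by apply/funext => p; rewrite mulN1r.
Qed.

Lemma derive_scalar_comp (g : R -> R) (g' : R) F p : is_derive (F p) 1 g g' ->
  differentiable F p ->
  differentiable (fun q => g (F q)) p /\
  (forall d, 'D_d (fun q => g (F q)) p = g' * 'D_d F p).
Proof.
move=> dg dF.
have dg' : differentiable g (F p).
  by apply/derivable1_diffP; exact: ex_derive.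
have dc : differentiable (g \o F) p by exact: differentiable_comp.
split=> // d; rewrite (deriveE _ dc) diff_comp//= diff1E// derive1E.
by rewrite (derive_val (f := g)) /GRing.scale/= mulrC -deriveE.
Qed.

Lemma elementary_smooth1 F : elementary F ->
  (forall p, differentiable F p) /\
  (forall d, elementary (fun p => 'D_d F p)).
Proof.
elim.
- move=> c; split=> [p|d]; first exact: differentiable_cst.
  rewrite (_ : (fun p => 'D_d (fun=> c) p) = fun=> 0 : R); first exact: elem_cst.
  by apply/funext => p; rewrite (derive_cst c).
- split=> [p|d]; first by have [] := differentiable_fst p.
  rewrite (_ : (fun p => 'D_d fst p) = fun=> d.1); first exact: elem_cst.
  by apply/funext => p; have [_ ->] := differentiable_fst p.
- split=> [p|d]; first by have [] := differentiable_snd p.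
  rewrite (_ : (fun p => 'D_d snd p) = fun=> d.2); first exact: elem_cst.
  by apply/funext => p; have [_ ->] := differentiable_snd p.
- move=> {}F G eF [dF DF] eG [dG DG]; split=> [p|d]; first exact: differentiableD.
  rewrite (_ : (fun p => _) = fun p => 'D_d F p + 'D_d G p); first exact: elem_add.
  by apply/funext => p; rewrite (deriveD (f := F) (g := G))//; exact: diff_derivable.
- move=> {}F G eF [dF DF] eG [dG DG]; split=> [p|d]; first exact: differentiableM.
  rewrite (_ : (fun p => _) = fun p => F p * 'D_d G p + G p * 'D_d F p).
    by apply: elem_add; exact: elem_mul.
  by apply/funext => p; rewrite (deriveM (f := F) (g := G))//; exact: diff_derivable.
- move=> {}F eF [dF DF]; split=> [p|d].
    by have [] := derive_scalar_comp (is_derive_sin (F p)) (dF p).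
  rewrite (_ : (fun p => _) = fun p => cos (F p) * 'D_d F p).
    by apply: elem_mul => //; exact: elem_cos.
  apply/funext => p.
  by have [_ ->] := derive_scalar_comp (is_derive_sin (F p)) (dF p).
- move=> {}F eF [dF DF]; split=> [p|d].
    by have [] := derive_scalar_comp (is_derive_cos (F p)) (dF p).
  rewrite (_ : (fun p => _) = fun p => - sin (F p) * 'D_d F p).
    by apply: elem_mul => //; apply: elementary_opp; exact: elem_sin.
  apply/funext => p.
  by have [_ ->] := derive_scalar_comp (is_derive_cos (F p)) (dF p).
- move=> k {}F eF [dF DF]; split=> [p|d].
    by have [] := derive_scalar_comp (is_derive_flat k (F p)) (dF p).
  rewrite (_ : (fun p => _) = fun p =>
    (flat k.+2 (F p) + - (k%:R * flat k.+1 (F p))) * 'D_d F p).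
    apply: elem_mul => //; apply: elem_add; first exact: elem_flat.
    apply: elementary_opp; apply: elem_mul; [exact: elem_cst|exact: elem_flat].
  apply/funext => p.
  by have [_ ->] := derive_scalar_comp (is_derive_flat k (F p)) (dF p).
Qed.

Lemma elementary_smooth F : elementary F -> smooth F.
Proof.
move=> eF s; suff : elementary (foldr (fun d (psi : R * R -> R) => 'D_d psi) F s).
  by move=> /elementary_smooth1[].
by elim: s => //= d s /elementary_smooth1[_]; exact.
Qed.

End smooth_class.

(** * Measures with a density *)

Section density.
Context d (T : measurableType d) (R : realType).
Variables (mu nu : {measure set T -> \bar R}) (w : T -> R).
Hypotheses (mw : measurable_fun setT w) (w0 : forall x, 0 <= w x).
Hypothesis nuE : forall A, measurable A -> nu A = (\int[mu]_(x in A) (w x)%:E)%E.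

Import HBNNSimple.
Local Open Scope ereal_scope.

(** Monotone approximation by simple functions reduces the claim to indicators, where it is [nuE].
    It serves twice: du dtheta on M has density [\1_manifold] in the plane, and dvol has density 1 /
    [conformal_inv] with respect to du dtheta. *)
Lemma ge0_integral_density f : measurable_fun setT f -> (forall x, 0 <= f x) ->
  \int[nu]_x f x = \int[mu]_x (f x * (w x)%:E).
Proof.
move=> mf f0; pose h := nnsfun_approx measurableT mf.
have hf x : (EFin \o h^~ x) n @[n --> \oo] --> f x.
  exact: cvg_nnsfun_approx.
have nd x : {homo (fun n => (h n x)%:E) : n m / (n <= m)%N >-> n <= m}.
  by move=> a b ab; rewrite lee_fin; exact/lefP/nd_nnsfun_approx.
transitivity (lim (\int[nu]_x (h n x)%:E @[n --> \oo])).
  rewrite -monotone_convergence//.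
  - by apply: eq_integral => x _; apply/esym/cvg_lim => //; exact: hf.
  - by move=> n; exact/measurable_EFinP.
  - by move=> n x _; rewrite lee_fin.
transitivity (lim (\int[mu]_x ((h n x)%:E * (w x)%:E) @[n --> \oo])); last first.
  rewrite -monotone_convergence//.
  - apply: eq_integral => x _; apply/cvg_lim => //.
    by apply: cvgeZr => //; exact: hf.
  - by move=> n; apply/measurable_EFinP; exact: measurable_funM.
  - by move=> n x _; rewrite lee_fin mulr_ge0.
  - by move=> x _ a b ab; rewrite lee_wpmul2r ?lee_fin//; exact: nd.
apply/congr_lim/funext => n.
move: (h n) => {h hf nd f mf f0} g.
transitivity (\int[nu]_x
   (\sum_(y \in range g) (y * \1_(g @^-1` [set y]) x)%:E)).
  by apply: eq_integral => t _; rewrite /= fimfunE -fsumEFin.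
have indich r : measurable_fun setT (fun x => (r * \1_(g @^-1` [set r]) x)%:E).
  by apply/measurable_EFinP; apply: measurable_funM.
rewrite ge0_integral_fsum//; last by move=> m y _; exact: nnfun_muleindic_ge0.
transitivity (\int[mu]_x (\sum_(y \in range g)
    (y * \1_(g @^-1` [set y]) x)%:E * (w x)%:E)); last first.
  apply: eq_integral => x _.
  rewrite -ge0_mule_fsuml => [|y]; last exact: nnfun_muleindic_ge0.
  by rewrite fsumEFin // -(fimfunE _ x).
rewrite ge0_integral_fsum//; last 2 first.
  - move=> y; apply: emeasurable_funM => //; exact/measurable_EFinP.
  - by move=> y x _; rewrite mule_ge0 ?lee_fin//; exact: nnfun_muleindic_ge0.
apply: eq_fsbigr => r rg.
have r0 : (0 <= r)%R by move/set_mem : rg => -[x _ <-].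
under [LHS]eq_integral do rewrite EFinM.
rewrite ge0_integralZl//; last by apply/measurable_EFinP.
under [RHS]eq_integral do rewrite EFinM -muleA.
rewrite ge0_integralZl//; last 2 first.
  - by apply/measurable_EFinP; exact: measurable_funM.
  - by move=> x _; rewrite lee_fin mulr_ge0.
congr (_ * _); rewrite integral_indic// setIT nuE//.
rewrite integral_mkcond; apply: eq_integral => x _.
by rewrite patchE indicE; case: ifPn => /= _; rewrite ?mul1e ?mul0e.
Qed.

Lemma integral_density f : nu.-integrable setT f ->
  \int[nu]_x f x = \int[mu]_x (f x * (w x)%:E).
Proof.
move=> /measurable_int mf.
rewrite integralE [RHS]integralE.
rewrite !ge0_integral_density//; [|exact: measurable_funeneg|exact: measurable_funepos].
by congr (_ - _); apply: eq_integral => x _;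
  rewrite !unlock /= muleC maxeMr ?lee_fin// mule0 ?muleN muleC.
Qed.

Lemma integrable_density f : nu.-integrable setT f <->
  measurable_fun setT f /\ mu.-integrable setT (fun x => f x * (w x)%:E).
Proof.
have E : measurable_fun setT f ->
    \int[nu]_x `|f x| = \int[mu]_x `|f x * (w x)%:E|.
  move=> mf; rewrite ge0_integral_density//; last exact: measurableT_comp.
  by apply: eq_integral => x _; rewrite abseM (@gee0_abs _ (w x)%:E)// lee_fin.
split=> [/integrableP[mf foo]|[mf /integrableP[_ foo]]].
- split=> //; apply/integrableP; split; last by rewrite -E.
  by apply: emeasurable_funM => //; exact/measurable_EFinP.
- by apply/integrableP; split=> //; rewrite E.
Qed.

End density.

(** * Borel measurability in the plane *)

Section plane_measurability.
Context {R : realType}.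

(** The sigma-algebra at hand is the product one. An open set belongs to it as the countable union
    of the rational squares that it contains. *)
Lemma open_plane_measurable (U : set (R * R)) :
  open U -> measurable (U : set (Defs.coord R)).
Proof.
move=> oU.
pose box (i : rat * rat * rat) : set (Defs.coord R) :=
  `]ratr i.1.1 - ratr i.2, ratr i.1.1 + ratr i.2[ `*`
  `]ratr i.1.2 - ratr i.2, ratr i.1.2 + ratr i.2[.
pose F i := if pselect (box i `<=` U) then box i else set0.
rewrite (_ : U = \bigcup_i F i); last first.
  apply/seteqP; split=> [[x y] Uxy|p [i _]]; last first.
    by rewrite /F; case: pselect => // sub /sub.
  have /nbhs_ballP[e /= e0 eU] := open_nbhs_nbhs (conj oU Uxy).
  have e30 : 0 < e / 3 by rewrite divr_gt0.
  have e23 : e / 3 < e / 2 by rewrite ltr_pM2l// ltf_pV2 ?posrE// ltr_nat.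
  (* A centre within e / 3 and a radius r between e / 3 and e / 2 give a square that contains the
     point and stays within 5 e / 6 of it. *)
  have [r] := rat_in_itvoo e23; rewrite in_itv/= => /andP[r1 r2].
  have [q1] : exists q, ratr q \in `]x - e / 3, x + e / 3[.
    by apply: rat_in_itvoo; lra.
  have [q2] : exists q, ratr q \in `]y - e / 3, y + e / 3[.
    by apply: rat_in_itvoo; lra.
  rewrite !in_itv/= => /andP[q21 q22] /andP[q11 q12].
  exists (q1, q2, r) => //; rewrite /F; case: pselect => [sub|[]].
    by split; rewrite /= in_itv/=; apply/andP; split; lra.
  move=> [a b] [/=]; rewrite !in_itv/= => /andP[a1 a2] /andP[b1 b2].
  apply: eU; split; rewrite /= /ball/= ltr_norml; apply/andP; split; lra.
apply: (countable_bigcupT_measurable (U := (rat * rat * rat)%type)).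
  exact: countableP.
move=> i; rewrite /F; case: pselect => [? | ?]; last exact: measurable0.
by apply: measurableX; exact: measurable_itv.
Qed.

Lemma continuous_plane_measurable (F : R * R -> R) :
  continuous F -> measurable_fun setT (F : Defs.coord R -> R).
Proof.
move=> cF; apply: (measurability _ (RGenOInfty.measurableE R)).
move=> _ [_ [x ->] <-]; rewrite setTI; apply: open_plane_measurable.
apply: open_comp; last exact: interval_open.
by move=> p _; exact: cF.
Qed.

End plane_measurability.

(** * The measure du dtheta on M *)

Section coordinate_measure.
Context {R : realType}.
Local Notation plane := (@lebesgue_measure R \x @lebesgue_measure R)%E.

Lemma coord_measureE (A : set (Defs.coord R)) : measurable A ->
  coord_measure R A = (\int[plane]_(p in A) (\1_manifold p : R)%:E)%E.
Proof.
move=> mA; rewrite integral_indic//; last exact: measurable_manifold.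
by rewrite /mrestr setIC.
Qed.

Lemma measurable_manifold_indic :
  measurable_fun setT (\1_manifold : Defs.coord R -> R).
Proof. by apply: measurable_indic; exact: measurable_manifold. Qed.

Lemma coord_integralE f : (coord_measure R).-integrable setT f ->
  (\int[coord_measure R]_p f p =
   \int[plane]_p (f p * (\1_manifold p : R)%:E))%E.
Proof.
apply: integral_density => //; first exact: measurable_manifold_indic.
exact: coord_measureE.
Qed.

Lemma coord_integrableP f : (coord_measure R).-integrable setT f <->
  measurable_fun setT f /\
  plane.-integrable setT (fun p => f p * (\1_manifold p : R)%:E)%E.
Proof.
apply: integrable_density => //; first exact: measurable_manifold_indic.
exact: coord_measureE.
Qed.

Definition annulus (a b : R) : set (Defs.coord R) := `[a, b] `*` `[0, 2 * pi[.

Lemma measurable_annulus a b : measurable (annulus a b).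
Proof. by apply: measurableX; exact: measurable_itv. Qed.

Lemma coord_measure_annulus a b : 2 * pi < a -> a <= b ->
  coord_measure R (annulus a b) = ((b - a) * (2 * pi))%:E.
Proof.
move=> pia ab; rewrite /= /mrestr.
rewrite (_ : annulus a b `&` manifold = annulus a b); last first.
  apply/setIidl => -[u t] [/= + tP]; rewrite in_itv/= => /andP[au _].
  by split => //=; rewrite in_itv/= andbT (lt_le_trans pia).
rewrite /annulus product_measure1E//; [|exact: measurable_itv..].
rewrite /= !lebesgue_measure_itv/= !lte_fin mulr_gt0 ?pi_gt0// sube0.
move: ab; rewrite le_eqVlt => /predU1P[->|->]; last by rewrite -EFinB -EFinM.
by rewrite ltxx subrr mul0r mul0e.
Qed.

Lemma coord_measure_annulus_le a b : a <= b ->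
  (coord_measure R (annulus a b) <= ((b - a) * (2 * pi))%:E)%E.
Proof.
move=> ab; have mA := measurable_annulus a b.
apply: (@le_trans _ _ ((lebesgue_measure \x lebesgue_measure)%E (annulus a b))).
  rewrite /= /mrestr le_measure// ?inE//.
  by apply: measurableI => //; exact: measurable_manifold.
rewrite /annulus product_measure1E//; [|exact: measurable_itv..].
rewrite /= !lebesgue_measure_itv/= !lte_fin mulr_gt0 ?pi_gt0// sube0.
move: ab; rewrite le_eqVlt => /predU1P[->|->]; last by rewrite -EFinB -EFinM.
by rewrite ltxx subrr mul0r mul0e.
Qed.

Lemma coord_ae (P : Defs.coord R -> Prop) :
  (forall p, manifold p -> P p) -> \forall p \ae coord_measure R, P p.
Proof.
move=> MP; exists (~` manifold); split.
- by apply: measurableC; exact: measurable_manifold.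
- by rewrite /= /mrestr setICl measure0.
- by apply: subsetC => p /MP.
Qed.

(** Besides integrability, the explicit bound (supremum times area) is recorded: the energy and the
    L^1 norm of the bump are estimated by it. *)
Lemma coord_bounded_integrable (f : Defs.coord R -> R) (a b M : R) :
  a <= b -> measurable_fun setT f ->
  (forall p, manifold p -> `|f p| <= M) ->
  (forall p, manifold p -> ~ (a <= p.1 <= b) -> f p = 0) ->
  (coord_measure R).-integrable setT (EFin \o f) /\
  (\int[coord_measure R]_p `|f p|%:E <= (M * ((b - a) * (2 * pi)))%:E)%E.
Proof.
move=> ab mf fM fout.
have M0 : 0 <= M.
  apply: le_trans (fM (2 * pi + 1, 0) _) => //; split; rewrite /= in_itv/= ?andbT.
    by rewrite ltrDl.
  by rewrite lexx/= mulr_gt0// pi_gt0.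
have le : (\int[coord_measure R]_p `|f p|%:E <= (M * ((b - a) * (2 * pi)))%:E)%E.
  apply: (@le_trans _ _ (\int[coord_measure R]_p (M * \1_(annulus a b) p)%:E))%E.
    apply: ae_ge0_le_integral => //.
    - by apply/measurable_EFinP; exact: measurableT_comp.
    - by move=> p _; rewrite lee_fin mulr_ge0.
    - apply/measurable_EFinP; apply: measurable_funM => //.
      by apply: measurable_indic; exact: measurable_annulus.
    apply: coord_ae => p Mp _; rewrite lee_fin indicE.
    have [pab|pab] := boolP (a <= p.1 <= b).
      rewrite mem_set ?mulr1 ?fM//; split; first by rewrite /= in_itv.
      by case: Mp.
    by rewrite fout ?normr0 ?mulr_ge0//; exact/negP.
  under eq_integral do rewrite EFinM.
  rewrite ge0_integralZl//; last first.
    by apply/measurable_EFinP; apply: measurable_indic; exact: measurable_annulus.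
  rewrite integral_indic//; last exact: measurable_annulus.
  by rewrite setIT EFinM lee_wpmul2l ?lee_fin//; exact: coord_measure_annulus_le.
split=> //; apply/integrableP; split; first exact/measurable_EFinP.
by apply: le_lt_trans le _; rewrite ltry.
Qed.

Lemma continuous_annulus_bounded (F : R * R -> R) (a b : R) : continuous F ->
  exists M, forall p, a <= p.1 <= b -> 0 <= p.2 <= 2 * pi -> `|F p| <= M.
Proof.
move=> cF.
have K : compact (`[a, b] `*` `[0, 2 * pi] : set (R * R)).
  by apply: compact_setX; exact: segment_compact.
have [M [Mr MP]] : bounded_set (F @` (`[a, b] `*` `[0, 2 * pi] : set (R * R))).
  apply: compact_bounded; apply: continuous_compact => //.
  by apply: continuous_subspaceT.
exists (M + 1) => p pa pt; apply: MP; first by rewrite ltrDl.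
by exists p => //; split; rewrite /= in_itv.
Qed.

End coordinate_measure.

(** * Test functions and integration by parts *)

Section test_functions.
Context {R : realType}.
Implicit Types (phi psi : R * R -> R) (d p : R * R).
Local Notation plane := (@lebesgue_measure R \x @lebesgue_measure R)%E.
Local Notation nu := (coord_measure R).

Lemma test_differentiable phi p : test_function phi -> differentiable phi p.
Proof. by case=> /(_ [::] p). Qed.

Lemma test_continuous phi : test_function phi -> continuous phi.
Proof. by move=> tphi p; apply/differentiable_continuous/test_differentiable. Qed.

Lemma derive_support phi d a b :
  (forall u t, ~ (a <= u <= b) -> phi (u, t) = 0) ->
  forall u t, ~ (a <= u <= b) -> 'D_d phi (u, t) = 0.
Proof.
move=> sup u t uab.
rewrite (near_eq_derive _ (g := cst 0)) ?derive_cst//.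
have cf : z.1 @[z --> (u, t)] --> u by exact: cvg_fst.
have [ua|au] := ltP u a.
  have : \forall z \near (u, t), z.1 < a.
    exact: cvgr_lt cf _ ua.
  apply: filterS => -[x y] /= xa; apply: sup => /andP[/le_lt_trans/(_ xa)].
  by rewrite ltxx.
have [bu|ub] := ltP b u; last by case: uab; rewrite au ub.
have : \forall z \near (u, t), b < z.1.
  exact: cvgr_gt cf _ bu.
apply: filterS => -[x y] /= bx; apply: sup => /andP[_ /(lt_le_trans bx)].
by rewrite ltxx.
Qed.

Lemma test_derive phi d : test_function phi -> test_function ('D_d phi).
Proof.
move=> [sphi per [a [b [pia sup]]]]; split.
- by move=> s p; have := sphi (rcons s d) p; rewrite foldr_rcons.
- move=> u t; rewrite /derive /=.
  rewrite (_ : (fun h => _) =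
      (fun h => h^-1 *: (phi (h *: d + (u, t)) - phi (u, t)))); first by [].
  apply/funext => h; congr (_ *: (_ - _)); last exact: per.
  rewrite [h *: d + (u, t)]surjective_pairing -[RHS]per; congr phi.
  by rewrite -addrA.
- by exists a, b; split=> // u t; exact: derive_support.
Qed.

Lemma is_derive_slice_u phi u t : differentiable phi (u, t) ->
  is_derive u 1 (fun x => phi (x, t)) ('D_dir_u phi (u, t)).
Proof.
move=> /diff_derivable dphi; have dp := dphi dir_u.
have E : (fun h => h^-1 *: (phi (h *: dir_u + (u, t)) - phi (u, t))) =
         (fun h => h^-1 *: (phi (h *: 1 + u, t) - phi (u, t))).
  apply/funext => h; congr (_ *: (phi _ - _)).
  by congr pair; rewrite /= scaler0 add0r.
by apply: DeriveDef; rewrite /derivable /derive/= -E.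
Qed.

Lemma is_derive_slice_theta phi u t : differentiable phi (u, t) ->
  is_derive t 1 (fun x => phi (u, x)) ('D_dir_theta phi (u, t)).
Proof.
move=> /diff_derivable dphi; have dp := dphi dir_theta.
have E : (fun h => h^-1 *: (phi (h *: dir_theta + (u, t)) - phi (u, t))) =
         (fun h => h^-1 *: (phi (u, h *: 1 + t) - phi (u, t))).
  apply/funext => h; congr (_ *: (phi _ - _)).
  by congr pair; rewrite /= scaler0 add0r.
by apply: DeriveDef; rewrite /derivable /derive/= -E.
Qed.

Lemma integral_derivative0 (G g : R -> R) (a b : R) : a < b -> continuous g ->
  (forall x : R, is_derive x 1 G (g x)) -> G a = G b ->
  (\int[lebesgue_measure]_(x in `[a, b]) (g x)%:E = 0)%E.
Proof.
move=> ab cg dG Gab.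
rewrite (@continuous_FTC2 _ _ G)// ?Gab ?subee//.
- exact: continuous_subspaceT.
- have cG x : {for x, continuous G}.
    by apply/differentiable_continuous/derivable1_diffP; have [] := dG x.
  split=> [x _| |].
  + by have [] := dG x.
  + by apply: cvg_at_right_filter; exact: cG.
  + by apply: cvg_at_left_filter; exact: cG.
- by move=> x _; rewrite derive1E; have [] := dG x.
Qed.

(** Fubini with the variable of differentiation innermost, then the fundamental theorem of calculus:
    boundary terms vanish in u by the support condition and cancel in theta by periodicity. The
    hypotheses are unbundled so as to apply directly to a product of test functions. *)
Lemma coord_integral_derivative d phi : d = dir_u \/ d = dir_theta ->
  (forall p, differentiable phi p) -> continuous ('D_d phi) ->
  (forall u t, phi (u, t + 2 * pi) = phi (u, t)) ->
  forall a b, 2 * pi < a ->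
  (forall u t, ~ (a <= u <= b) -> phi (u, t) = 0) ->
  (forall u t, ~ (a <= u <= b) -> 'D_d phi (u, t) = 0) ->
  (\int[nu]_p ('D_d phi p)%:E = 0)%E.
Proof.
move=> dE dphi cD per a b pia sup supD.
have [ab|ba] := leP a b; last first.
  rewrite integral0_eq// => -[u t] _; rewrite supD// => /andP[au ub].
  by have := le_lt_trans (le_trans au ub) ba; rewrite ltxx.
have mD : measurable_fun setT ('D_d phi : Defs.coord R -> R).
  exact: continuous_plane_measurable.
have [M MP] := continuous_annulus_bounded a b cD.
have [iD _] : nu.-integrable setT (EFin \o ('D_d phi)) /\
    (\int[nu]_p `|'D_d phi p|%:E <= (Num.max M 0 * ((b - a) * (2 * pi)))%:E)%E.
  apply: coord_bounded_integrable => //.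
    move=> [u t] [_ /=]; rewrite in_itv/= => /andP[t0 t1].
    have [uab|uab] := boolP (a <= u <= b).
      by rewrite le_max MP//= t0 ltW.
    by rewrite supD ?normr0 ?le_max ?lexx ?orbT//; exact/negP.
  by move=> [u t] _ /= uab; rewrite supD.
have [_ iP] := (coord_integrableP _).1 iD.
rewrite coord_integralE//.
(* The endpoints c < a and b + 1 > b lie outside the support, so phi vanishes at both, and c is
   still inside M. *)
pose c := (a + 2 * pi) / 2.
have ca : c < a by rewrite /c; lra.
have pic : 2 * pi < c by rewrite /c; lra.
case: dE => dE.
- rewrite -(integral21_prod_meas1 iP) integral0_eq// => t _.
  rewrite /fubini_G.
  have [tP|tP] := boolP (t \in `[0, 2 * pi[); last first.
    rewrite integral0_eq// => u _; rewrite indicE memNset ?mule0// => -[_ /=].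
    exact/negP.
  have -> : (fun u => (EFin \o 'D_d phi) (u, t) * (\1_manifold (u, t) : R)%:E)%E =
      (fun u => ('D_d phi (u, t))%:E) \_ `[c, b + 1].
    apply/funext => u; rewrite patchE indicE.
    have [uab|uab] := boolP (a <= u <= b); last first.
      by rewrite /= supD ?mul0e ?if_same//; exact/negP.
    move/andP : uab => [au ub].
    rewrite !mem_set ?mule1//=.
      by rewrite in_itv/= (le_trans (ltW ca))//= (le_trans ub)// lerDl.
    by split=> //=; rewrite in_itv/= andbT (lt_le_trans pia).
  rewrite -integral_mkcond.
  apply: (@integral_derivative0 (fun u => phi (u, t))).
  + by rewrite (lt_trans ca)// (le_lt_trans ab)// ltrDl.
  + move=> u; apply: (@continuous_comp _ _ _ (fun x => (x, t)) ('D_d phi)).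
      exact: (cvg_pair cvg_id (cvg_cst t)).
    exact: cD.
  + by move=> u; rewrite dE; exact: is_derive_slice_u.
  + rewrite !sup//.
    * by move=> /andP[_]; rewrite gerDl ler10.
    * by move=> /andP[/le_lt_trans /(_ ca)]; rewrite ltxx.
- rewrite -(integral12_prod_meas1 iP) integral0_eq// => u _.
  rewrite /fubini_F.
  have [uP|uP] := boolP (u \in `]2 * pi, +oo[); last first.
    rewrite integral0_eq// => t _; rewrite indicE memNset ?mule0// => -[/= + _].
    exact/negP.
  have -> : (fun t => (EFin \o 'D_d phi) (u, t) * (\1_manifold (u, t) : R)%:E)%E =
      (fun t => ('D_d phi (u, t))%:E) \_ `[0, 2 * pi[.
    apply/funext => t; rewrite patchE indicE.
    have [tP|tP] := boolP (t \in `[0, 2 * pi[).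
      by rewrite !mem_set ?mule1.
    by rewrite !memNset ?mule0//= => [|[_]]; exact/negP.
  have cDu : continuous (fun t => 'D_d phi (u, t)).
    move=> t; apply: (@continuous_comp _ _ _ (fun x => (u, x)) ('D_d phi)).
      exact: (cvg_pair (cvg_cst u) cvg_id).
    exact: cD.
  rewrite -integral_mkcond integral_itv_bndo_bndc; last first.
    by apply/measurable_EFinP/measurable_funTS; exact: continuous_measurable_fun.
  apply: (@integral_derivative0 (fun t => phi (u, t))) => //.
  + by rewrite mulr_gt0// pi_gt0.
  + by move=> t; rewrite dE; exact: is_derive_slice_theta.
  + by rewrite -per add0r.
Qed.

Lemma test_integrableM phi psi : test_function phi -> continuous psi ->
  nu.-integrable setT (EFin \o (fun p => phi p * psi p)).
Proof.
move=> tphi cpsi; have [_ _ [a [b [pia sup]]]] := tphi.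
have mphi : measurable_fun setT (fun p : Defs.coord R => phi p * psi p).
  apply: continuous_plane_measurable => p.
  by apply: continuousM; [exact: test_continuous|exact: cpsi].
have [ab|ba] := leP a b; last first.
  rewrite (_ : EFin \o _ = cst 0%E); first exact: integrable0.
  apply/funext => -[u t] /=; rewrite sup ?mul0r// => /andP[au ub].
  by have := le_lt_trans (le_trans au ub) ba; rewrite ltxx.
have [M MP] : exists M, forall p, a <= p.1 <= b -> 0 <= p.2 <= 2 * pi ->
    `|phi p * psi p| <= M.
  apply: continuous_annulus_bounded => p.
  by apply: continuousM; [exact: test_continuous|exact: cpsi].
have [] // := @coord_bounded_integrable R (fun p => phi p * psi p) a b (Num.max M 0) ab mphi.
- move=> [u t] [_ /=]; rewrite in_itv/= => /andP[t0 t1].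
  have [uab|uab] := boolP (a <= u <= b).
    by rewrite le_max MP//= t0 ltW.
  by rewrite sup ?mul0r ?normr0 ?le_max ?lexx ?orbT//; exact/negP.
- by move=> [u t] _ /= uab; rewrite sup// mul0r.
Qed.

Lemma test_integration_by_parts d phi psi : d = dir_u \/ d = dir_theta ->
  test_function phi -> test_function psi ->
  \int[nu]_p (phi p * 'D_d psi p) = - \int[nu]_p ('D_d phi p * psi p).
Proof.
move=> dE tphi tpsi.
have tDphi := test_derive d tphi; have tDpsi := test_derive d tpsi.
have i1 := test_integrableM tphi (test_continuous tDpsi).
have i2 := test_integrableM tDphi (test_continuous tpsi).
apply/eqP; rewrite -subr_eq0 opprK -RintegralD//; apply/eqP.
have DE p : 'D_d (phi * psi) p = phi p * 'D_d psi p + 'D_d phi p * psi p.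
  rewrite deriveM; last 2 first.
    exact/diff_derivable/test_differentiable.
    exact/diff_derivable/test_differentiable.
  by rewrite /GRing.scale/= (mulrC (psi p)).
rewrite /Rintegral -[RHS]/(fine 0%E); congr fine.
have [_ per [a [b [pia sup]]]] := tphi.
have [_ per' _] := tpsi.
transitivity (\int[nu]_p ('D_d (phi * psi) p)%:E)%E.
  by apply: eq_integral => p _; rewrite DE.
apply: (@coord_integral_derivative d (phi * psi) dE _ _ _ a b pia).
- by move=> p; apply: differentiableM; exact: test_differentiable.
- rewrite (_ : 'D_d _ = fun p => phi p * 'D_d psi p + 'D_d phi p * psi p).
    move=> p; apply: cvgD; apply: cvgM.
    - exact: (test_continuous tphi).
    - exact: (test_continuous tDpsi).
    - exact: (test_continuous tDphi).
    - exact: (test_continuous tpsi).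
  by apply/funext => p; exact: DE.
- by move=> u t; rewrite -[LHS]/(phi _ * psi _) per per'.
- by move=> u t /sup s; rewrite -[LHS]/(phi _ * psi _) s mul0r.
- by move=> u t uab; rewrite DE sup// (derive_support d sup)// !mul0r addr0.
Qed.

End test_functions.

(** * Uniqueness of weak derivatives *)

Section pi_system.
Context d (T : measurableType d) (R : realType).
Variables (mu : {measure set T -> \bar R}) (G : set (set T)) (g : (set T)^nat).
Hypotheses (mG : measurable = <<s G >>) (setIG : setI_closed G).
Hypotheses (Gg : forall i, G (g i)) (g_cover : \bigcup_k (g k) = setT).
Local Open Scope ereal_scope.

(** The positive and negative parts of f induce two measures that agree on the pi-system, hence on
    all measurable sets; so every integral of f vanishes. *)
Lemma pi_system_integral_ae0 f : mu.-integrable setT f ->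
  (forall A, G A -> \int[mu]_(x in A) f x = 0) ->
  ae_eq mu setT f (cst 0).
Proof.
move=> intf fG.
have induced (h : T -> \bar R) : measurable_fun setT h -> (forall x, 0 <= h x) ->
    exists m : {measure set T -> \bar R}, forall A, m A = \int[mu]_(x in A) h x.
  move=> mh h0; pose m A := \int[mu]_(x in A) h x.
  have m0 : m set0 = 0 by rewrite /m integral_set0.
  have mge0 A : 0 <= m A by apply: integral_ge0.
  have msigma : semi_sigma_additive m by exact: semi_sigma_additive_nng_induced.
  pose M : {measure set T -> \bar R} :=
    HB.pack m (isMeasure.Build _ _ _ m m0 mge0 msigma).
  by exists M.
have [mp mpE] := induced _ (measurable_int _ (integrable_funepos measurableT intf)) (funepos_ge0 f).
have [mn mnE] := induced _ (measurable_int _ (integrable_funeneg measurableT intf)) (funeneg_ge0 f).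
have finp A : measurable A -> \int[mu]_(x in A) f^\+ x \is a fin_num.
  move=> mA; apply: integrable_fin_num => //.
  by apply: (integrableS measurableT) => //; exact: integrable_funepos.
have finn A : measurable A -> \int[mu]_(x in A) f^\- x \is a fin_num.
  move=> mA; apply: integrable_fin_num => //.
  by apply: (integrableS measurableT) => //; exact: integrable_funeneg.
have GM A : G A -> measurable A by move=> GA; rewrite mG; exact: sub_sigma_algebra.
have mpn A : measurable A -> mp A = mn A.
  apply: (measure_unique G g) => //.
    move=> B GB; rewrite mpE mnE; have := fG B GB; rewrite integralE => /eqP.
    rewrite sube_eq; [|exact: finp (GM _ GB)|exact: fin_num_adde_defr].
    by rewrite add0e => /eqP.
  by move=> k; rewrite mpE ltey_eq (finp _ (GM _ (Gg k))).
apply: integral_ae_eq => // E _ mE.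
rewrite [RHS]integral0_eq// integralE -mpE -mnE mpn// subee//.
by rewrite mnE finn.
Qed.

End pi_system.

Section plane_generator.
Context {R : realType}.

Definition quadrants : set (set (Defs.coord R)) :=
  [set A | exists x y, A = `]x, +oo[ `*` `]y, +oo[].

(** A rectangle is the intersection of two preimages under the projections. Rays generate the Borel
    sets of the line, and a half-plane is a countable union of quadrants whose other corner
    coordinate goes to minus infinity. *)
Lemma measurable_plane_quadrants :
  @measurable _ (Defs.coord R) = <<s quadrants >>.
Proof.
have sG : sigma_algebra setT <<s quadrants >> by exact: smallest_sigma_algebra.
have ray (f : Defs.coord R -> R) :
    (forall x, <<s quadrants >> (f @^-1` `]x, +oo[)) ->
    forall A : set (measurableTypeR R), measurable A -> <<s quadrants >> (f @^-1` A).
  move=> fray A mA.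
  pose S := [set B : set R | <<s quadrants >> (f @^-1` B)].
  suff : (@ocitv R).-sigma.-measurable `<=` S by apply.
  rewrite RGenOInfty.measurableE; apply: smallest_sub.
    case: sG => s0 sC sU; split; rewrite /S/=.
    - by rewrite preimage_set0.
    - by move=> B sB; rewrite setTD preimage_setC -setTD; exact: sC.
    - by move=> F sF; rewrite preimage_bigcup; exact: sU.
  by move=> _ [x ->]; exact: fray.
apply/seteqP; split; last first.
  apply: smallest_sub; first exact: sigma_algebra_measurable.
  by move=> _ [x [y ->]]; apply: measurableX; exact: measurable_itv.
rewrite measurable_prod_measurableType.
apply: smallest_sub => // _ [A mA [B mB <-]].
have -> : A `*` B = (fst @^-1` A) `&` (snd @^-1` B) by [].
have [s0 sC sU] := sG.
have sI X Y : <<s quadrants >> X -> <<s quadrants >> Y -> <<s quadrants >> (X `&` Y).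
  move=> sX sY; have := @measurableI _ (g_sigma_algebraType quadrants) X Y.
  by apply.
have archi (x : R) : exists k : nat, - k%:R < x.
  exists (Num.truncn `|x|).+1; rewrite ltrNl (le_lt_trans (ler_norm _))// normrN.
  exact: truncnS_gt.
apply: sI; apply: ray => // x.
- rewrite (_ : _ @^-1` _ = \bigcup_k (`]x, +oo[ `*` `]- k%:R, +oo[)).
    by apply: sU => k; apply: sub_sigma_algebra; exists x, (- k%:R).
  apply/seteqP; split=> [[u t] /= xu|[u t] [k _ []//]].
  by have [k kt] := archi t; exists k => //; split => //=; rewrite in_itv/= andbT.
- rewrite (_ : _ @^-1` _ = \bigcup_k (`]- k%:R, +oo[ `*` `]x, +oo[)).
    by apply: sU => k; apply: sub_sigma_algebra; exists (- k%:R), x.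
  apply/seteqP; split=> [[u t] /= xt|[u t] [k _ []//]].
  by have [k ku] := archi u; exists k => //; split => //=; rewrite in_itv/= andbT.
Qed.

Lemma quadrants_setI_closed : setI_closed quadrants.
Proof.
move=> _ _ [x [y ->]] [x' [y' ->]]; exists (Num.max x x'), (Num.max y y').
apply/seteqP; split=> -[u t] /=; rewrite !in_itv/= !andbT !gt_max.
  by move=> [[-> ->] [-> ->]].
by move=> [/andP[-> ->] /andP[-> ->]].
Qed.

Lemma quadrants_cover :
  \bigcup_k (`]- k%:R, +oo[ `*` `]- k%:R, +oo[) = [set: Defs.coord R].
Proof.
apply/seteqP; split=> // -[u t] _.
exists (Num.truncn (Num.max `|u| `|t|)).+1 => //.
have H : Num.max `|u| `|t| < (Num.truncn (Num.max `|u| `|t|)).+1%:R by exact: truncnS_gt.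
split; rewrite /= in_itv/= andbT ltrNl (le_lt_trans _ H)// le_max -normrN.
  by rewrite ler_norm.
by rewrite -(normrN t) ler_norm orbT.
Qed.

End plane_generator.

Section weak_derivative_unique.
Context {R : realType}.
Local Notation nu := (coord_measure R).

Lemma flat_step_cvg (x : R) :
  flat 0 (k.+1%:R * x - 1) @[k --> \oo] --> ((0 < x)%R%:R : R).
Proof.
have [x0|x0] := ltP 0 x; last first.
  rewrite (_ : (fun k => _) = cst 0); first exact: cvg_cst.
  apply/funext => k; rewrite flat_le0E// subr_le0 (le_trans _ (ler01))//.
  by rewrite mulr_ge0_le0.
(* Let y be the argument of [flat]. Once k.+1 * x >= 2, y is at least half of k.+1 * x, so exp(-1/y)
   >= 1 - 1/y >= 1 - 2 / (k.+1 * x). *)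
have cl : 1 - 2 / x * k.+1%:R^-1 @[k --> \oo] --> (1 : R).
  rewrite -[X in _ --> X]subr0; apply: cvgB; first exact: cvg_cst.
  rewrite -[X in _ --> X](mulr0 (2 / x)); apply: cvgMr; exact: cvg_harmonic.
rewrite -[X in _ --> X]/(1 : R).
apply: (squeeze_cvgr _ cl); [near=> k | exact: cvg_cst].
have k2 : 2 / x < k.+1%:R.
  have : 2 / x < k%:R by near: k; exact: nbhs_infty_gtr.
  by move=> /lt_trans; apply; rewrite ltr_nat.
rewrite ltr_pdivrMr// in k2.
have y0 : 0 < k.+1%:R * x - 1 by lra.
rewrite -[X in _ && (_ <= X)]/(0`!%:R) flat_le andbT flat_gt0E// expr0 mul1r.
apply: le_trans (expR_ge1Dx _); rewrite lerD2l lerN2.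
rewrite -[leLHS]mul1r ler_pdivrMr//.
have -> : 2 / x * k.+1%:R^-1 * (k.+1%:R * x - 1) = 2 - 2 / (k.+1%:R * x).
  by field; rewrite gt_eqF//= pnatr_eq0.
by rewrite lerBrDr -lerBrDl ler_pdivrMr; lra.
Unshelve. all: by end_near. Qed.

(* Smooth approximations of the indicator of ]alpha, N[ x ]gamma, 2 pi[: for
   theta and gamma in [0, 2 pi[ the product of sines is positive exactly when
   theta > gamma, and it is 2 pi-periodic in theta. *)
Definition step_test (alpha gamma N : R) (k : nat) (p : R * R) : R :=
  flat 0 (k.+1%:R * (p.1 - alpha) - 1) * (flat 0 (k.+1%:R * (N - p.1) - 1) *
  flat 0 (k.+1%:R * (sin ((p.2 - gamma) / 2) * sin (p.2 / 2)) - 1)).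

Lemma step_test_function alpha gamma N k : 2 * pi <= alpha ->
  test_function (step_test alpha gamma N k).
Proof.
move=> pia; split.
- apply: elementary_smooth.
  have cst c := @elem_cst R c.
  have fstE := @elem_fst R; have sndE := @elem_snd R.
  apply: elem_mul; [|apply: elem_mul]; apply: elem_flat; apply: elem_add => //;
    apply: elem_mul => //.
  + exact: elem_add.
  + by apply: elem_add => //; exact: elementary_opp.
  + apply: elem_mul; apply: elem_sin; apply: elem_mul => //.
    exact: elem_add.
- move=> u t; rewrite /step_test/=.
  (* A full turn flips the sign of each half-angle sine, so their product is periodic. *)
  have -> : (t + 2 * pi - gamma) / 2 = (t - gamma) / 2 + pi by field.
  have -> : (t + 2 * pi) / 2 = t / 2 + pi by field.
  by rewrite !sinDpi mulrNN.
(* The -1 in the arguments of [flat] keeps the support at distance 1 / k.+1 from alpha, hence inside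
   u > 2 pi even when alpha = 2 pi. *)
- exists (alpha + k.+1%:R^-1), N; split.
    by rewrite (le_lt_trans pia)// ltrDl invr_gt0.
  move=> u t ut; rewrite /step_test/=.
  have [ua|ua] := ltP u (alpha + k.+1%:R^-1).
    rewrite flat_le0E ?mul0r// subr_le0 -ler_pdivlMl// mulr1.
    by rewrite lerBlDl ltW.
  have [uN|uN] := ltP N u; last by case: ut; rewrite ua uN.
  rewrite (@flat_le0E _ 0 (_ * (N - u) - 1)) ?mul0r ?mulr0//.
  rewrite subr_le0 (le_trans _ ler01)// mulr_ge0_le0// subr_le0; exact: ltW.
Qed.

Lemma half_sines_gt0 (gamma t : R) : 0 <= gamma < 2 * pi -> 0 <= t < 2 * pi ->
  (0 < sin ((t - gamma) / 2) * sin (t / 2)) = (gamma < t).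
Proof.
move=> /andP[g0 g1] /andP[t0 t1].
have [gt|tg] := ltP gamma t.
  by rewrite mulr_gt0// sin_gt0_pi//; lra.
apply/negbTE; rewrite -leNgt mulr_le0_ge0//.
  by rewrite -oppr_ge0 -sinN; apply: sin_ge0_pi; lra.
by apply: sin_ge0_pi; lra.
Qed.

Lemma step_test_cvg alpha gamma N (p : R * R) : 0 <= gamma < 2 * pi -> 0 <= p.2 < 2 * pi ->
  step_test alpha gamma N k p @[k --> \oo] -->
  ((alpha < p.1 < N)%R%:R * (gamma < p.2)%R%:R : R).
Proof.
move=> g0 pt; rewrite -(half_sines_gt0 g0 pt) -(subr_gt0 alpha) -(subr_gt0 p.1 N).
rewrite -mulnb natrM -mulrA.
by apply: cvgM; [exact: flat_step_cvg|apply: cvgM; exact: flat_step_cvg].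
Qed.

End weak_derivative_unique.

Lemma Lfun2_sqr d (T : measurableType d) (R : realType)
    (mu : {measure set T -> \bar R}) (f : T -> R) : measurable_fun setT f ->
  mu.-integrable setT (EFin \o (fun x => f x ^+ 2)) -> f \in Lfun mu 2%:E.
Proof.
move=> mf /integrableP[_ foo]; rewrite inE; apply/andP; split; rewrite inE//=.
rewrite /finite_norm unlock poweR_lty//.
rewrite (le_lt_trans _ foo)// le_eqVlt; apply/orP; left; apply/eqP.
apply: eq_integral => x _ /=.
by rewrite powR_mulrn// -normrX.
Qed.

Section weak_unique.
Context {R : realType}.
Local Notation nu := (coord_measure R).

Lemma test_measurable phi : test_function phi ->
  measurable_fun setT (phi : Defs.coord R -> R).
Proof. by move=> tphi; apply: continuous_plane_measurable; exact: test_continuous. Qed.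

Lemma test_Lfun phi : test_function phi -> (phi : Defs.coord R -> R) \in Lfun nu 2%:E.
Proof.
move=> tphi; apply: Lfun2_sqr; first exact: test_measurable.
exact: (test_integrableM tphi (test_continuous tphi)).
Qed.

(** By dominated convergence, testing against [step_test] shows that a has integral zero over each
    quadrant cut down to a strip u < N; the pi-system lemma then applies. The strips are there
    because du dtheta has infinite mass on M, so a square-integrable a need not be integrable. *)
Lemma weak_null (a : L2coord R) :
  (forall phi, test_function phi -> \int[nu]_p (a p * phi p) = 0) ->
  a = (0 : L2coord R) %[ae nu].
Proof.
move=> a0.
have iaphi phi : test_function phi -> nu.-integrable setT (EFin \o (fun p => a p * phi p)).
  move=> tphi; apply/Lfun1_integrable/(@Lfun2_mul_Lfun1 _ _ _ _ a phi);
    first exact: LfunP.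
  exact: test_Lfun.
have ma : measurable_fun setT a by [].
(* The line theta = 0 is left out because every [step_test] vanishes on it; it is null and is
   discarded at the end. *)
pose K (N : R) : set (Defs.coord R) := `]2 * pi, N[ `*` `]0, 2 * pi[.
have mK N : measurable (K N) by apply: measurableX; exact: measurable_itv.
(* On a strip of finite area, L^2 is contained in L^1; this also provides the dominating function
   below. *)
have strip (N : R) : 2 * pi < N ->
    nu.-integrable setT (EFin \o (fun p => a p * \1_(annulus (2 * pi) N) p)).
  move=> piN; have m1 : measurable_fun setT (\1_(annulus (2 * pi) N) : Defs.coord R -> R).
    by apply: measurable_indic; exact: measurable_annulus.
  apply/Lfun1_integrable/(@Lfun2_mul_Lfun1 _ _ _ _ a); first exact: LfunP.
  apply: Lfun2_sqr => //.
  have [] // := @coord_bounded_integrable R (fun p => \1_(annulus (2 * pi) N) p ^+ 2) (2 * pi) N 1.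
  + exact: ltW.
  + exact: measurable_funX.
  + move=> p _; rewrite indicE; case: (_ \in _) => /=; first by rewrite expr1n normr1.
    by rewrite expr0n normr0.
  + move=> p _ pN; rewrite indicE memNset ?expr0n// => -[/=].
    by rewrite in_itv.
have KN0 (N : R) : 2 * pi < N -> ae_eq nu setT (fun p => (a p * \1_(K N) p)%:E) (cst 0%E).
  move=> piN.
  have iK : nu.-integrable setT (fun p => (a p * \1_(K N) p)%:E).
    apply: le_integrable (strip _ piN) => //.
      by apply/measurable_EFinP; apply: measurable_funM => //; exact: measurable_indic.
    move=> p _; rewrite lee_fin !normrM ler_wpM2l// !indicE !ger0_norm// ler_nat.
    have [/set_mem pK|//] := boolP (p \in K N).
    rewrite mem_set//; case: pK => /=; rewrite !in_itv/= => /andP[p1 p2] /andP[p3 p4].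
    by split; rewrite /= in_itv/= ltW//= ltW.
  apply: (pi_system_integral_ae0 measurable_plane_quadrants quadrants_setI_closed _ quadrants_cover iK).
    by move=> k; exists (- k%:R), (- k%:R).
  move=> _ [x [y ->]].
  (* The corner of the quadrant is moved into the closure of M in u and to theta >= 0, as
     [step_test] requires; the trace on M is unchanged. *)
  pose alpha := Num.max x (2 * pi); pose gamma := Num.max y 0.
  have pialpha : 2 * pi <= alpha by rewrite le_max lexx orbT.
  have gamma0 : 0 <= gamma by rewrite le_max lexx orbT.
  pose F p : R := a p * (((alpha < p.1 < N)%R)%:R * ((gamma < p.2)%R)%:R).
  have FE p : manifold p -> (((fun p => (a p * \1_(K N) p)%:E) \_ (`]x, +oo[ `*` `]y, +oo[)) p = (F p)%:E)%E.
    move=> [/=]; rewrite !in_itv/= andbT => p1 /andP[p2 p3].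
    rewrite patchE /F !gt_max p1 andbT.
    have -> : (p \in `]x, +oo[ `*` `]y, +oo[) = (x < p.1) && (y < p.2).
      by apply/idP/idP => [/set_mem[/=]|/andP[H1 H2]];
        [rewrite !in_itv/= !andbT => -> ->|apply/mem_set; split;
          rewrite /= in_itv/= andbT].
    rewrite indicE.
    have -> : (p \in K N) = (p.1 < N) && (0 < p.2).
      by apply/idP/idP => [/set_mem[/=]|/andP[H1 H2]];
        [rewrite !in_itv/= p1 p3 /= andbT => -> ->|
         apply/mem_set; split; rewrite /= in_itv/= ?p1 ?H1 ?H2].
    case: (x < p.1); case: (y < p.2); case: (p.1 < N); case: (0 < p.2) => //=;
      by rewrite ?mulr1n ?mulr0n ?mulr0 ?mul0r ?mulr1 ?mulr0.
  have mq : measurable (`]x, +oo[ `*` `]y, +oo[ : set (Defs.coord R)).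
    by apply: measurableX; exact: measurable_itv.
  have mF : measurable_fun setT F.
    apply: measurable_funM => //.
    rewrite (_ : (fun p => _) = \1_(`]alpha, N[ `*` `]gamma, +oo[)).
      by apply: measurable_indic; apply: measurableX; exact: measurable_itv.
    apply/funext => p; rewrite -natrM mulnb indicE; congr (_%:R); congr nat_of_bool.
    apply/idP/idP => [/andP[H1 H2]|/set_mem[/=]].
      by apply/mem_set; split; rewrite /= in_itv/= ?andbT.
    by rewrite !in_itv/= andbT => -> ->.
  transitivity (\int[nu]_p (F p)%:E)%E.
    rewrite integral_mkcond; apply: ae_eq_integral => //.
    - apply/(measurable_restrictT _ mq); apply: measurable_funTS.
      exact: (measurable_int _ iK).
    - exact/measurable_EFinP.
    - by apply: coord_ae => p /FE + _.
  have [gpi|pig] := ltP gamma (2 * pi); last first.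
    transitivity (\int[nu]_p (cst 0%E p : \bar R))%E; last exact: integral0.
    apply: ae_eq_integral => //; first exact/measurable_EFinP.
    apply: coord_ae => p [_ /=]; rewrite in_itv/= => /andP[_ p3] _.
    by rewrite /F (ltNge gamma) (ltW (lt_le_trans p3 pig)) !mulr0.
  have [_ _ cv] : [/\ nu.-integrable setT (EFin \o F),
      ([sequence (\int[nu]_p `|(a p * step_test alpha gamma N k p)%:E - (F p)%:E|)%E]_k @ \oo --> 0%E) &
      ([sequence (\int[nu]_p (a p * step_test alpha gamma N k p)%:E)%E]_k @ \oo --> (\int[nu]_p (F p)%:E)%E)].
    apply: (@dominated_convergence _ _ _ nu setT measurableT
      (fun k p => (a p * step_test alpha gamma N k p)%:E) (EFin \o F)
      (fun p => `|(a p * \1_(annulus (2 * pi) N) p)%:E|)%E).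
    - by move=> k; have /iaphi/measurable_int := step_test_function gamma N k pialpha.
    - exact/measurable_EFinP.
    - apply: coord_ae => p [_ /=]; rewrite in_itv/= => p2 _.
      apply/cvg_EFin; first by near=> k.
      apply: cvgMr; apply: step_test_cvg => //.
      by rewrite gamma0.
    - apply: integrable_abse => //; exact: strip.
    - apply: coord_ae => p [/=]; rewrite in_itv/= andbT => p1 p2 k _.
      rewrite lee_fin (normrM (a p) (step_test _ _ _ _ _)) (normrM (a p) (\1_ _ _)).
      rewrite ler_wpM2l// indicE (ger0_norm (ler0n _ _)).
      have f1 (z : R) : 0 <= flat 0 z <= 1.
        by rewrite flat_ge0 -[X in _ <= X]/(0`!%:R) flat_le.
      have /andP[A0 A1] := f1 (k.+1%:R * (p.1 - alpha) - 1).
      have /andP[B0 B1] := f1 (k.+1%:R * (N - p.1) - 1).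
      have /andP[C0 C1] := f1 (k.+1%:R * (sin ((p.2 - gamma) / 2) * sin (p.2 / 2)) - 1).
      rewrite /step_test ger0_norm ?mulr_ge0//.
      have [pN|Np] := leP p.1 N.
        rewrite mem_set ?mulr_ile1 ?mulr_ge0//.
        by split=> //=; rewrite in_itv/= pN ltW.
      rewrite (@flat_le0E _ 0 (_ * (N - p.1) - 1)) ?mul0r ?mulr0//.
      by rewrite subr_le0 (le_trans _ ler01)// mulr_ge0_le0// subr_le0 ltW.
  apply/esym; move: cv; rewrite (_ : [sequence _]_k = cst 0%E).
    by move=> /(cvg_lim (@ereal_hausdorff R)) <-; apply/esym/lim_cst.
  apply/funext => k /=.
  have ts := step_test_function gamma N k pialpha.
  have := a0 _ ts; rewrite /Rintegral => /eqP; rewrite -eqe fineK => [/eqP //|].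
  by apply: integrable_fin_num => //; exact: iaphi.
have line : nu (setT `*` [set 0] : set (Defs.coord R)) = 0%E.
  rewrite /= /mrestr; apply/eqP; rewrite eq_le measure_ge0 andbT.
  apply: (@le_trans _ _ ((lebesgue_measure \x lebesgue_measure)%E (setT `*` [set 0] : set (Defs.coord R)))).
    rewrite le_measure// ?inE.
    - by apply: measurableI; [apply: measurableX => //;
      exact: measurable_set1|exact: measurable_manifold].
    - by apply: measurableX => //; exact: measurable_set1.
  by rewrite product_measure1E//= lebesgue_measure_set1 mule0.
have nline : \forall p \ae nu, p.2 != 0.
  exists (setT `*` [set 0]); split => //.
    by apply: measurableX => //; exact: measurable_set1.
  by move=> [u t] /= /negP; rewrite negbK => /eqP ->.
have all0 : \forall p \ae nu, forall n : nat, a p * \1_(K (2 * pi + n.+1%:R)) p = 0.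
  apply/ae_foralln => n.
  have /KN0 : 2 * pi < 2 * pi + n.+1%:R :> R by rewrite ltrDl.
  by apply: filterS => p /(_ I)[].
have inM : \forall p \ae nu, manifold p by exact: coord_ae.
apply: filterS3 inM nline all0 => p [/= p1 p2] p20 /(_ (Num.truncn `|p.1|)) + _.
rewrite !in_itv/= andbT in p1 p2; case/andP : p2 => p2 p3.
rewrite indicE mem_set ?mulr1//; split; rewrite /= in_itv/= ?p1/=.
  rewrite (le_lt_trans (ler_norm _))// (lt_trans (truncnS_gt _))// ltrDr.
  by rewrite mulr_gt0// pi_gt0.
by rewrite p3 andbT lt_neqAle eq_sym p20.
Unshelve. all: by end_near. Qed.

(** [weak_partial] is picked by [xget], so it cannot be computed; this lemma lets any explicit weak
    derivative stand for it inside integrals. *)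
Lemma weak_partial_unique d (f : L2 R) (a : L2coord R) :
  weak_derivative d f a -> weak_partial d f = a %[ae nu].
Proof.
move=> wa; have wp : weak_derivative d f (weak_partial d f).
  by apply: (@xgetPex _ (0 : L2coord R) [set a | weak_derivative d f a]); exists a.
have := @weak_null (weak_partial d f - a); case=> [phi tphi|].
  transitivity (\int[nu]_p (weak_partial d f p * phi p) - \int[nu]_p (a p * phi p)).
    rewrite -RintegralB//.
    - by apply: eq_Rintegral => p _; rewrite -mulrBl.
    - apply/Lfun1_integrable/(@Lfun2_mul_Lfun1 _ _ _ _ (weak_partial d f) phi).
        exact: LfunP.
      exact: test_Lfun.
    - apply/Lfun1_integrable/(@Lfun2_mul_Lfun1 _ _ _ _ a phi); first exact: LfunP.
      exact: test_Lfun.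
  have := wa _ tphi; rewrite (wp _ tphi) => /oppr_inj ->; exact: subrr.
move=> N [mN N0 sub]; exists N; split=> // p /= np; apply: sub => /= H; apply: np => _.
by apply/eqP; rewrite -subr_eq0; apply/eqP; exact: H.
Qed.

End weak_unique.

(** * The Laplacian on test functions *)

Section vol_density.
Context {R : realType}.
Local Notation nu := (coord_measure R).

(* The truncation makes this inverse of the conformal factor positive and
   continuous on the whole plane, without changing it on M. *)
Definition conformal_inv (p : R * R) : R := Num.max p.1 2 ^+ 2 * ln (Num.max p.1 2).

Lemma conformal_inv_gt0 p : 0 < conformal_inv p.
Proof.
have m1 : 1 < Num.max p.1 2 by rewrite lt_max (ltr1n _ 2) orbT.
by rewrite mulr_gt0 ?ln_gt0// exprn_gt0// (lt_trans ltr01).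
Qed.

Lemma continuous_conformal_inv : continuous conformal_inv.
Proof.
move=> p; have m0 : 0 < Num.max p.1 2 by rewrite lt_max ltr0n orbT.
have cm : Num.max q.1 2 @[q --> p] --> Num.max p.1 2.
  apply: (@continuous_max _ _ fst (cst 2) p); [exact: cvg_fst|exact: cvg_cst].
apply: cvgM.
  apply: (@cvg_comp _ _ _ (fun q => Num.max q.1 2) (fun x => x ^+ 2) _ _ _ cm).
  exact: exprn_continuous.
apply: (@cvg_comp _ _ _ (fun q => Num.max q.1 2) (@ln R) _ _ _ cm).
exact: continuous_ln.
Qed.

Lemma conformal_factorE (p : R * R) :
  manifold p -> conformal_factor p.1 = (conformal_inv p)^-1.
Proof.
move=> [/= + _]; rewrite in_itv/= andbT => pip.
have p2 : 2 <= p.1 by have := @pi_ge2 R; lra.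
by rewrite /conformal_factor /conformal_inv (max_l p2) [RHS]invfM.
Qed.

Lemma measurable_conformal :
  measurable_fun setT (fun p : Defs.coord R => (conformal_inv p)^-1).
Proof.
apply: continuous_plane_measurable => p; apply: cvgV.
  by rewrite gt_eqF// conformal_inv_gt0.
exact: continuous_conformal_inv.
Qed.

Lemma conformal_ge0 p : 0 <= (conformal_inv p)^-1.
Proof. by rewrite invr_ge0 ltW// conformal_inv_gt0. Qed.

Lemma vol_coordE (A : set (Defs.coord R)) : measurable A ->
  vol A = (\int[nu]_(p in A) ((conformal_inv p)^-1)%:E)%E.
Proof.
move=> mA; rewrite integral_mkcond.
rewrite (ge0_integral_density measurable_manifold_indic _ coord_measureE)//;
  last 2 first.
- apply/(measurable_restrictT _ mA)/measurable_funTS/measurable_EFinP.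
  exact: measurable_conformal.
- by move=> p; rewrite patchE; case: ifPn => // _; rewrite lee_fin conformal_ge0.
rewrite /vol [LHS]integral_mkcond; apply: eq_integral => p _.
rewrite !patchE in_setI indicE.
have [pM|pM] := boolP (p \in manifold); last by rewrite andbF mule0.
by rewrite andbT mule1 conformal_factorE//; exact: set_mem.
Qed.

Lemma vol_integrableP f : (@vol R).-integrable setT f <-> measurable_fun setT f /\
  nu.-integrable setT (fun p => f p * ((conformal_inv p)^-1)%:E)%E.
Proof.
apply: integrable_density; [exact: measurable_conformal|exact: conformal_ge0|].
exact: vol_coordE.
Qed.

Lemma vol_integralE f : (@vol R).-integrable setT f ->
  (\int[vol]_p f p = \int[nu]_p (f p * ((conformal_inv p)^-1)%:E))%E.
Proof.
apply: integral_density; [exact: measurable_conformal|exact: conformal_ge0|].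
exact: vol_coordE.
Qed.

(** The factor c is 1 for the bump itself and [conformal_inv] for its image under H. *)
Lemma test_vol_Lfun (phi : R * R -> R) (c : R * R -> R) : test_function phi ->
  continuous c -> (fun p : Defs.coord R => phi p * c p) \in Lfun (@vol R) 2%:E.
Proof.
move=> tphi cc; have cphi := test_continuous tphi.
have mpc : measurable_fun setT (fun p : Defs.coord R => phi p * c p).
  by apply: continuous_plane_measurable => p; apply: cvgM; [exact: cphi|exact: cc].
apply: Lfun2_sqr => //; apply/vol_integrableP; split.
  by apply/measurable_EFinP; exact: measurable_funX.
rewrite (_ : (fun p => _) =
  EFin \o (fun p => phi p * (phi p * c p ^+ 2 * (conformal_inv p)^-1))).
  apply: (test_integrableM tphi) => p; apply: cvgM.
    apply: cvgM; first exact: cphi.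
    apply: (@cvg_comp _ _ _ c (fun x => x ^+ 2) _ _ _ (cc p)).
    exact: exprn_continuous.
  apply: cvgV; first by rewrite gt_eqF// conformal_inv_gt0.
  exact: continuous_conformal_inv.
by apply/funext => p /=; rewrite -EFinM; congr EFin; ring.
Qed.

End vol_density.

Section laplacian_of_test_function.
Context {R : realType}.
Local Notation nu := (coord_measure R).
Implicit Types (phi : R * R -> R) (f h v : L2 R).

Lemma test_weak_derivative d phi f (a : L2coord R) : d = dir_u \/ d = dir_theta ->
  test_function phi -> f = phi :> (_ -> _) -> a = 'D_d phi :> (_ -> _) ->
  weak_derivative d f a.
Proof.
by move=> dE tphi fE aE psi tpsi; rewrite fE aE; exact: test_integration_by_parts.
Qed.

Lemma test_L2coord phi : test_function phi ->
  exists a : L2coord R, a = phi :> (_ -> _).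
Proof. by move=> tphi; exists (Lfun_Sub (lee1n 2) (test_Lfun tphi)). Qed.

Lemma test_W12 phi f : test_function phi -> f = phi :> (_ -> _) -> W12 f.
Proof.
move=> tphi fE; split.
- have [a aE] := test_L2coord (test_derive dir_u tphi).
  by exists a; apply: (test_weak_derivative _ tphi fE aE); left.
- have [a aE] := test_L2coord (test_derive dir_theta tphi).
  by exists a; apply: (test_weak_derivative _ tphi fE aE); right.
Qed.

Lemma energyC f h : energy f h = energy h f.
Proof.
have dotC (a b c d : R) : a * b + c * d = b * a + d * c by ring.
by rewrite /energy; under eq_Rintegral do rewrite dotC. Qed.

(** The weak derivatives of 0 are chosen ones, so they vanish only almost everywhere, by uniqueness.
    This is what lets a test function approximate itself in [W12_0]. *)
Lemma W12norm_sq0 : W12norm_sq (0 : L2 R) = 0.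
Proof.
have w0 d : weak_partial d (0 : L2 R) = (0 : L2coord R) %[ae nu].
  apply: weak_partial_unique => psi _.
  have zero (z w : R * R -> R) : (forall p, z p = 0) ->
      \int[nu]_p (z p * w p) = 0.
    move=> z0; rewrite /Rintegral integral0_eq// => p _.
    by rewrite z0 mul0r.
  by rewrite !zero ?oppr0.
have -> : W12norm_sq (0 : L2 R) = energy (0 : L2 R) 0.
  by rewrite /W12norm_sq L2norm_sqr -[X in L2inner X _](scale0r 0) L2innerZl mul0r add0r.
rewrite /energy /Rintegral -[RHS]/(fine 0%E); congr fine.
transitivity (\int[nu]_p (cst 0%E p : \bar R))%E; last exact: integral0.
apply: ae_eq_integral => //.
  by apply/measurable_EFinP; apply: measurable_funD; exact: measurable_funM.
have dot0 (a b c d : R) : a = 0 -> c = 0 -> a * b + c * d = 0.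
  by move=> -> ->; rewrite !mul0r addr0.
apply: filterS2 (w0 dir_u) (w0 dir_theta) => p /(_ I) u0 /(_ I) t0 _.
exact: congr1 (dot0 _ _ _ _ u0 t0).
Qed.

Lemma test_form_domain bc phi f : test_function phi -> f = phi :> (_ -> _) ->
  form_domain bc f.
Proof.
move=> tphi fE; case: bc => /=; last exact: test_W12 tphi fE.
split; first exact: test_W12 tphi fE.
by move=> e e0; exists f; rewrite subrr W12norm_sq0 fE.
Qed.

Lemma form_domain_W12 bc f : form_domain bc f -> W12 f.
Proof. by case: bc => // -[]. Qed.

Lemma test_weak_partial d phi f : d = dir_u \/ d = dir_theta ->
  test_function phi -> f = phi :> (_ -> _) ->
  weak_partial d f = 'D_d phi %[ae nu].
Proof.
move=> dE tphi fE; have [a aE] := test_L2coord (test_derive d tphi).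
have := weak_partial_unique (test_weak_derivative dE tphi fE aE).
by apply: filterS => p /(_ I) fa _; rewrite fa aE.
Qed.

Lemma test_energy phi f v : test_function phi -> f = phi :> (_ -> _) ->
  energy f v = \int[nu]_p ('D_dir_u phi p * weak_partial dir_u v p +
                           'D_dir_theta phi p * weak_partial dir_theta v p).
Proof.
move=> tphi fE; rewrite /energy /Rintegral; congr fine.
have mD d := test_measurable (test_derive d tphi).
apply: ae_eq_integral => //.
- by apply/measurable_EFinP; apply: measurable_funD; exact: measurable_funM.
- by apply/measurable_EFinP; apply: measurable_funD; exact: measurable_funM.
- apply: filterS2 (test_weak_partial (or_introl erefl) tphi fE)
    (test_weak_partial (or_intror erefl) tphi fE) => p /(_ I) eu /(_ I) et _.
  have dotE (a a' b c c' d : R) : a = a' -> c = c' ->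
    (a * b + c * d)%:E = (a' * b + c' * d)%:E by move=> -> ->.
  exact: dotE.
Qed.

Lemma test_energy_sqr phi f : test_function phi -> f = phi :> (_ -> _) ->
  energy f f = \int[nu]_p ('D_dir_u phi p ^+ 2 + 'D_dir_theta phi p ^+ 2).
Proof.
move=> tphi fE; rewrite (test_energy _ tphi fE) /Rintegral; congr fine.
have mD d := test_measurable (test_derive d tphi).
apply: ae_eq_integral => //.
- by apply/measurable_EFinP; apply: measurable_funD; exact: measurable_funM.
- by apply/measurable_EFinP; apply: measurable_funD; exact: measurable_funX.
- apply: filterS2 (test_weak_partial (or_introl erefl) tphi fE)
    (test_weak_partial (or_intror erefl) tphi fE) => p /(_ I) eu /(_ I) et _.
  have sqrE (a a' c c' : R) : a = a' -> c = c' ->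
    (a' * a + c' * c)%:E = (a' ^+ 2 + c' ^+ 2)%:E by move=> -> ->.
  exact: sqrE.
Qed.

(** The witness is - (phi_uu + phi_theta theta) / g. The form identity is the weak derivative of v
    tested against phi_u and phi_theta, so it holds on all of W^{1,2} and covers both boundary
    conditions. *)
Lemma test_laplacian bc phi f : test_function phi -> f = phi :> (_ -> _) ->
  exists h : L2 R, laplacian bc f h.
Proof.
move=> tphi fE.
have tu := test_derive dir_u tphi; have tt := test_derive dir_theta tphi.
have tuu := test_derive dir_u tu; have ttt := test_derive dir_theta tt.
have cinv := @continuous_conformal_inv R.
pose hu : L2 R := Lfun_Sub (lee1n 2) (test_vol_Lfun tuu cinv).
pose ht : L2 R := Lfun_Sub (lee1n 2) (test_vol_Lfun ttt cinv).
exists (- (hu + ht)); split; first exact: test_form_domain tphi fE.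
move=> v /form_domain_W12[[au vu] [at_ vt]].
have wu : weak_derivative dir_u v (weak_partial dir_u v).
  by apply: (@xgetPex _ (0 : L2coord R) [set a | weak_derivative dir_u v a]); exists au.
have wt : weak_derivative dir_theta v (weak_partial dir_theta v).
  by apply: (@xgetPex _ (0 : L2coord R) [set a | weak_derivative dir_theta v a]);
    exists at_.
(* The factor 1 / g in the witness cancels the density of dvol. *)
have half psi (k w : L2 R) : k = (fun p => psi p * conformal_inv p) :> (_ -> _) ->
    L2inner k w = \int[nu]_p (w p * psi p).
  move=> kE; rewrite /L2inner /Rintegral vol_integralE; last exact: L2inner_integrable.
  congr fine; apply: eq_integral => p _; rewrite kE -EFinM; congr EFin.
  have c0 := conformal_inv_gt0 p; field; exact: lt0r_neq0.
have Eu := etrans (half _ hu v erefl) (wu _ tu).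
have Et := etrans (half _ ht v erefl) (wt _ tt).
have negD (x y z : R) : z = x + y -> z = - (- x + - y) by move=> ->; ring.
rewrite L2innerNl L2innerDl Eu Et; apply: negD.
rewrite (test_energy _ tphi fE) RintegralD//.
- by congr (_ + _); apply: eq_Rintegral => p _; exact: mulrC.
- apply/Lfun1_integrable/(@Lfun2_mul_Lfun1 _ _ _ nu ('D_dir_u phi)); last exact: LfunP.
  exact: test_Lfun.
- apply/Lfun1_integrable/(@Lfun2_mul_Lfun1 _ _ _ nu ('D_dir_theta phi));
  last exact: LfunP.
  exact: test_Lfun.
Qed.

Lemma laplacian_symmetric bc f h f' h' :
  laplacian bc f h -> laplacian bc f' h' -> L2inner h f' = L2inner f h'.
Proof.
move=> [df Ef] [df' Ef'].
exact: etrans (esym (Ef _ df')) (etrans (energyC _ _) (etrans (Ef' _ df) (L2innerC _ _))).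
Qed.

End laplacian_of_test_function.

(** * Radial bumps *)

Section radial_bump_estimates.
Context {R : realType}.
Variable r : R.
Hypotheses (pir : 2 * pi < r) (er : expR 1 <= r).
Local Notation nu := (coord_measure R).

Let r0 : 0 < r. Proof. by rewrite (lt_le_trans _ er)// expR_gt0. Qed.
Let r2 : 2 <= r. Proof. by apply: le_trans er; have := @expR_ge1Dx R 1; lra. Qed.

(** A parabola positive exactly on ]r, 2 r[. The factor r^-2 makes it a function of u / r, so the
    bumps are dilates of one profile. *)
Definition bump_arg (u : R) : R := (u - r) * (2 * r - u) * r ^- 2.

Definition radial_bump (p : R * R) : R := flat 0 (bump_arg p.1).

Lemma bump_support u t : ~ (r <= u <= 2 * r) -> radial_bump (u, t) = 0.
Proof.
move=> ur; rewrite /radial_bump /bump_arg/= flat_le0E// mulr_le0_ge0 ?invr_ge0 ?exprn_ge0 ?(ltW r0)//.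
have [ur'|ru] := ltP u r; first by rewrite mulr_le0_ge0//; have := r0; lra.
have [ur'|u2r] := ltP (2 * r) u; first by rewrite mulr_ge0_le0//; have := r0; lra.
by case: ur; rewrite ru u2r.
Qed.

Lemma bump_test : test_function radial_bump.
Proof.
split=> //; last by exists r, (2 * r); split=> // u t; exact: bump_support.
apply: elementary_smooth; apply: elem_flat; apply: elem_mul; last exact: elem_cst.
apply: elem_mul; first exact: elem_add (elem_fst) (elem_cst _).
apply: elem_add; [exact: elem_cst|exact: elementary_opp elem_fst].
Qed.

Lemma bump_ge0 p : 0 <= radial_bump p.
Proof. exact: flat_ge0. Qed.

Lemma bump_le1 p : radial_bump p <= 1.
Proof. by rewrite -[leRHS]/(0`!%:R) flat_le. Qed.

Lemma bump_ge p : 5 / 4 * r <= p.1 <= 7 / 4 * r -> expR (- 16) <= radial_bump p.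
Proof.
move=> /andP[p1 p2].
(* On the middle half of the support both linear factors are at least r / 4. *)
have q16 : 16^-1 <= bump_arg p.1.
  rewrite /bump_arg ler_pdivlMr ?exprn_gt0//.
  have : 1 / 4 * r * (1 / 4 * r) <= (p.1 - r) * (2 * r - p.1).
    by apply: ler_pM; have := r0; lra.
  by apply: le_trans; rewrite expr2; lra.
rewrite /radial_bump flat_gt0E; last by rewrite (lt_le_trans _ q16).
by rewrite expr0 mul1r ler_expR lerN2 invf_ple ?posrE// (lt_le_trans _ q16).
Qed.

Lemma derive_bump_theta p : 'D_dir_theta radial_bump p = 0.
Proof.
case: p => u t.
have := is_derive_slice_theta (test_differentiable (u, t) bump_test).
by move=> /@derive_val <-; exact: (derive_cst (radial_bump (u, t))).
Qed.

(** The constant is 2! from [flat_le], and |3 r - 2 u| <= r on the support. *)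
Lemma derive_bump_u p : `|'D_dir_u radial_bump p| <= 2 / r.
Proof.
case: p => u t; have [ur|ur] := boolP (r <= u <= 2 * r); last first.
  rewrite (derive_support dir_u bump_support) ?normr0 ?divr_ge0 ?(ltW r0)//.
  exact/negP.
have := is_derive_slice_u (test_differentiable (u, t) bump_test).
move=> /@derive_val <-.
have dq : is_derive u 1 bump_arg ((3 * r - 2 * u) * r ^- 2).
  rewrite /bump_arg; apply: is_derive_eq.
  rewrite /GRing.scale/=; ring.
have df := @is_derive1_comp _ (flat 0) bump_arg u _ _ (is_derive_flat 0 _) dq.
rewrite -[X in `|X|]/('D_1 (flat 0 \o bump_arg) u) (@derive_val _ _ _ _ _ _ _ df).
rewrite mul0r subr0 !normrM (ger0_norm (flat_ge0 _ _)) ler_pM ?flat_ge0 ?mulr_ge0//.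
  exact: flat_le.
rewrite (ger0_norm (_ : 0 <= r ^- 2)); last by rewrite invr_ge0 exprn_ge0// ltW.
rewrite ler_pdivrMr ?exprn_gt0// expr2 mulKf ?gt_eqF// ler_norml.
by case/andP : ur => u1 u2; apply/andP; split; lra.
Qed.

Lemma bump_energy (f : L2 R) : f = radial_bump :> (_ -> _) -> energy f f <= 8 * pi / r.
Proof.
move=> fE; rewrite (test_energy_sqr bump_test fE).
have mD d := test_measurable (test_derive d bump_test).
have [iD leD] : nu.-integrable setT (EFin \o (fun p => 'D_dir_u radial_bump p ^+ 2 + 'D_dir_theta radial_bump p ^+ 2)) /\
   (\int[nu]_p `|'D_dir_u radial_bump p ^+ 2 + 'D_dir_theta radial_bump p ^+ 2|%:E <=
     ((2 / r) ^+ 2 * ((2 * r - r) * (2 * pi)))%:E)%E.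
  apply: coord_bounded_integrable.
  - by have := r0; lra.
  - by apply: measurable_funD; exact: measurable_funX.
  - move=> p _; rewrite derive_bump_theta expr0n addr0 normrX lerXn2r ?nnegrE//.
      by rewrite divr_ge0// ltW.
    exact: derive_bump_u.
  - move=> [u t] _ /= ur; rewrite derive_bump_theta expr0n addr0.
    by rewrite (derive_support dir_u bump_support)// expr0n.
rewrite (le_trans (ler_norm _))// (le_trans (le_normr_Rintegral _ iD))//.
rewrite -lee_fin /Rintegral fineK; last first.
  apply: integrable_fin_num => //.
  by have /integrable_norm := iD.
apply: le_trans leD _; rewrite lee_fin le_eqVlt; apply/orP; left; apply/eqP.
by field; rewrite gt_eqF.
Qed.

(** On the support u^2 log u >= r^2, since r >= e makes the logarithm at least 1; the coordinate
    area of the support is 2 pi r. *)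
Lemma bump_integral : (\int[vol]_p (radial_bump p)%:E <= (2 * pi / r)%:E)%E.
Proof.
have mb := test_measurable bump_test.
rewrite (ge0_integral_density measurable_conformal conformal_ge0 vol_coordE);
  last 2 first.
- exact/measurable_EFinP.
- by move=> p; rewrite lee_fin bump_ge0.
have [_ le] : nu.-integrable setT (EFin \o (fun p => radial_bump p * (conformal_inv p)^-1)) /\
   (\int[nu]_p `|radial_bump p * (conformal_inv p)^-1|%:E <=
     ((r ^+ 2)^-1 * ((2 * r - r) * (2 * pi)))%:E)%E.
  apply: coord_bounded_integrable.
  - by have := r0; lra.
  - by apply: measurable_funM => //; exact: measurable_conformal.
  - move=> [u t] _; have [ur|ur] := boolP (r <= u <= 2 * r); last first.
      rewrite bump_support ?mul0r ?normr0 ?invr_ge0 ?exprn_ge0 ?(ltW r0)//.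
      exact/negP.
    rewrite ger0_norm; last by rewrite mulr_ge0 ?bump_ge0// conformal_ge0.
    rewrite -[leRHS]mul1r ler_pM ?bump_ge0 ?bump_le1 ?conformal_ge0//.
    rewrite lef_pV2 ?posrE ?conformal_inv_gt0 ?exprn_gt0//.
    rewrite /conformal_inv/= max_l; last by case/andP : ur => + _; have := r2; lra.
    case/andP : ur => ru _; rewrite -[leLHS]mulr1 ler_pM ?exprn_ge0 ?(ltW r0)//.
      by rewrite lerXn2r ?nnegrE ?(ltW r0)// (le_trans _ ru)// ltW.
    by rewrite -[leLHS](@expRK R) ler_ln ?posrE ?expR_gt0// ?(lt_le_trans r0)// (le_trans er).
  - by move=> [u t] _ /= ur; rewrite bump_support// mul0r.
apply: (@le_trans _ _ _ _ _ (le_trans _ le)).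
  apply: ge0_le_integral => //.
  - by move=> p _; rewrite -EFinM lee_fin mulr_ge0 ?bump_ge0 ?conformal_ge0.
  - by apply/measurable_EFinP; apply: measurable_funM => //;
    exact: measurable_conformal.
  - apply/measurable_EFinP; apply: measurableT_comp => //.
    by apply: measurable_funM => //; exact: measurable_conformal.
  - by move=> p _; rewrite -EFinM lee_fin ler_norm.
rewrite lee_fin le_eqVlt; apply/orP; left; apply/eqP.
by field; rewrite gt_eqF.
Qed.

(** Only the middle half of the support is kept: there phi^2 >= exp(-32), the density is at least 1
    / ((2 r)^2 log(2 r)), and the coordinate area is pi r. *)
Lemma bump_norm (f : L2 R) : f = radial_bump :> (_ -> _) ->
  expR (- 32) * (pi / 4) / (r * ln (2 * r)) <= L2inner f f.
Proof.
move=> fE; have mb := test_measurable bump_test.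
have ln0 : 0 < ln (2 * r) by apply: ln_gt0; have := r2; lra.
pose m := expR (- 32) * ((2 * r) ^+ 2 * ln (2 * r))^-1.
have m0 : 0 <= m.
  by rewrite mulr_ge0 ?expR_ge0// invr_ge0 mulr_ge0 ?exprn_ge0 ?(ltW ln0)// mulr_ge0 ?(ltW r0).
rewrite /L2inner /Rintegral vol_integralE; last exact: L2inner_integrable.
rewrite -lee_fin fineK; last first.
  apply: integrable_fin_num => //.
  by have /vol_integrableP[] := L2inner_integrable f f.
pose B := annulus (5 / 4 * r) (7 / 4 * r).
apply: (@le_trans _ _ (\int[nu]_p (m * \1_B p)%:E)%E).
  under eq_integral do rewrite EFinM.
  have mB : measurable B by exact: measurable_annulus.
  rewrite ge0_integralZl//; last first.
    by apply/measurable_EFinP; apply: measurable_indic.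
  rewrite integral_indic// setIT.
  rewrite [X in (_ * X)%E](_ : _ = ((7 / 4 * r - 5 / 4 * r) * (2 * pi))%:E); last first.
    by apply: coord_measure_annulus; have := pir; have := @pi_ge0 R; have := r0; lra.
  rewrite -EFinM lee_fin le_eqVlt; apply/orP; left; apply/eqP.
  by rewrite /m; field; rewrite !gt_eqF.
apply: ge0_le_integral => //.
- by move=> p _; rewrite lee_fin mulr_ge0.
- by apply/measurable_EFinP; apply: measurable_funM => //; apply: measurable_indic;
  exact: measurable_annulus.
- have /measurable_int := L2inner_integrable f f => mf.
  apply: emeasurable_funM; first exact: mf.
  by apply/measurable_EFinP; exact: measurable_conformal.
- move=> [u t] _; rewrite fE /= -EFinM lee_fin indicE.
  have [/set_mem[/= uB _]|_] := boolP ((u, t) \in B); last first.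
    by rewrite mulr0 mulr_ge0 ?conformal_ge0// mulr_ge0// bump_ge0.
  rewrite in_itv/= in uB; rewrite mulr1 /m ler_pM ?expR_ge0//.
  + by rewrite invr_ge0 mulr_ge0 ?exprn_ge0 ?(ltW ln0)// mulr_ge0 ?(ltW r0).
  + rewrite (_ : - 32 = - 16 + - 16); last by ring.
    by rewrite expRD ler_pM ?expR_ge0// bump_ge.
  + case/andP : uB => u1 u2.
    have u2' : 2 <= u by have := r2; lra.
    rewrite lef_pV2 ?posrE ?conformal_inv_gt0 ?mulr_gt0 ?exprn_gt0 ?mulr_gt0//.
    rewrite /conformal_inv/= (max_l u2') ler_pM ?exprn_ge0 ?ln_ge0//.
    * by lra.
    * by lra.
    * by rewrite lerXn2r ?nnegrE; have := r0; lra.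
    * by rewrite ler_ln ?posrE; have := r0; lra.
Qed.

End radial_bump_estimates.

(** * Pairing of L^oo with L^1 *)

Section Linf_pairing.
Context {R : realType}.

Lemma Lnormy_ae d (T : measurableType d) (mu : {measure set T -> \bar R})
    (f : T -> R) (M : R) : ('N[mu]_+oo[EFin \o f] <= M%:E)%E ->
  \forall x \ae mu, `|f x| <= M.
Proof.
rewrite unlock; case: ifPn => [_ /ess_supP|muT _].
  by apply: filterS => x /=; rewrite lee_fin.
(* In this branch of the definition of the norm the whole space is null. *)
exists setT; split=> //; apply/eqP; rewrite eq_le measure_ge0 andbT.
by rewrite leNgt.
Qed.

Lemma L2inner_Linf_L1 (f h : L2 R) (M : R) : 0 <= M -> (forall p, 0 <= h p) ->
  ('N[vol]_+oo[EFin \o f] <= M%:E)%E ->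
  ((L2inner f h)%:E <= M%:E * \int[vol]_p (h p)%:E)%E.
Proof.
move=> M0 h0 /Lnormy_ae fM; have ifh := L2inner_integrable f h.
rewrite /L2inner /Rintegral fineK; last exact: integrable_fin_num.
rewrite -ge0_integralZl//; last 2 first.
- exact/measurable_EFinP.
- by move=> p _; rewrite lee_fin.
apply: le_trans (_ : \int[vol]_p `|f p * h p|%:E <= _)%E.
  rewrite (le_trans (lee_abs _))//.
  apply: le_trans (le_abse_integral _ _ _) _ => //.
  exact: (measurable_int _ ifh).
apply: ae_ge0_le_integral => //.
- exact/measurable_EFinP/measurableT_comp/measurable_funM.
- by move=> p _; rewrite mule_ge0 ?lee_fin.
- by apply: emeasurable_funM => //; exact/measurable_EFinP.
- apply: filterS fM => p fp _.
  by rewrite -EFinM lee_fin normrM (ger0_norm (h0 p)) ler_wpM2r.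
Qed.

End Linf_pairing.

(** * Choice of the parameters and contradiction *)

Theorem theorem5p7 (R : realType) (bc : boundary_condition)
    (T : R -> L2 R -> L2 R) :
  semigroup_generated_by_opp (laplacian bc) T -> ~ ultracontractive T.
Proof.
move=> TH ultra.
have pi0 := @pi_gt0 R.
(* The constants of the bump estimates: |phi|^2 >= A / (r L) and energy at most B / r. *)
pose A : R := expR (- 32) * (pi / 4); pose B : R := 8 * pi.
have A0 : 0 < A by rewrite mulr_gt0 ?expR_gt0// divr_gt0.
have B0 : 0 < B by rewrite mulr_gt0.
have AB : A <= B.
  rewrite /A /B (@le_trans _ _ (1 * (pi / 4)))//; last by lra.
  by rewrite ler_pM2r ?divr_gt0// -expR0 ler_expR; lra.
(* Makes 2 t E = L / 4 for E = 2 B L / A, whatever L is. *)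
pose t := A / (16 * B).
have t0 : 0 < t by rewrite divr_gt0 ?mulr_gt0.
have t1 : t <= 1 by rewrite ler_pdivrMr ?mulr_gt0// mul1r; lra.
have [C [C0 CT]] : exists C : R, 0 <= C /\
    forall f : L2 R, ('N[vol]_+oo[EFin \o T t f] <= (C * L2norm f)%:E)%E.
  have [C CT] := ultra t (introT andP (conj t0 t1)).
  exists (Num.max C 0); split=> [|f]; first by rewrite le_max lexx orbT.
  apply: le_trans (CT f) _; rewrite lee_fin ler_wpM2r ?L2norm_ge0//.
  by rewrite le_max lexx.
pose D : R := 2 * pi.
(* The first term beats the constant in [key4]; the second gives r > 2 pi and r >= e through exp(L)
   >= 1 + L. *)
pose L := 16 * (C ^+ 2 * D ^+ 2) / A + (16 + 4 * pi).
have L16 : 16 + 4 * pi <= L.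
  by rewrite lerDr divr_ge0 ?(ltW A0)// mulr_ge0// mulr_ge0 ?sqr_ge0.
pose r := expR L / 2.
have r2E : 2 * r = expR L by rewrite /r mulrC divfK.
have pir : 2 * pi < r.
  by have := expR_ge1Dx L; lra.
have er : expR 1 <= r.
  rewrite /r ler_pdivlMr// [in leRHS](_ : L = 1 + (L - 1)); last by ring.
  rewrite expRD ler_pM2l ?expR_gt0// (le_trans _ (expR_ge1Dx _))//; lra.
have r0 : 0 < r by rewrite (lt_le_trans _ er)// expR_gt0.
have cst1 : continuous (cst 1 : R * R -> R) by move=> p; exact: cvg_cst.
have [f fE] : exists f : L2 R, f = radial_bump r :> (_ -> _).
  exists (Lfun_Sub (lee1n 2) (test_vol_Lfun (bump_test pir er) cst1)).
  by apply/funext => p /=; rewrite mulr1.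
have tf := bump_test pir er.
have [h fh] := test_laplacian bc tf fE.
have N2 := bump_norm pir er fE; rewrite r2E expRK -/A in N2.
have Q := bump_energy pir er fE; rewrite -/B in Q.
have hf : L2inner h f = energy f f.
  by case: fh => df /(_ f df) ->.
(* Twice the bound B L / A on the Rayleigh quotient, since the semigroup bound needs a strict
   inequality. *)
pose E := 2 * B / A * L.
have L0 : 0 < L by lra.
have E0 : 0 < E by rewrite mulr_gt0// divr_gt0// mulr_gt0.
have QE : L2inner h f < E * L2inner f f.
  rewrite hf (le_lt_trans Q)//.
  apply: (@lt_le_trans _ _ (E * (A / (r * L)))); last by rewrite ler_pM2l.
  rewrite (_ : E * _ = 2 * (B / r)); last first.
    by rewrite /E; field; rewrite !gt_eqF.
  have : 0 < B / r by rewrite divr_gt0.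
  lra.
have lower := semigroup_lower_bound TH (@laplacian_symmetric R bc) fh E0 t0 QE.
rewrite (_ : 2 * (t * E) = L / 4) in lower; last first.
  by rewrite /t /E; field; rewrite !gt_eqF.
have f0 p : 0 <= f p by rewrite fE; exact: bump_ge0.
have upper : L2inner (T t f) f <= C * L2norm f * (D / r).
  have Cn0 : 0 <= C * L2norm f by rewrite mulr_ge0 ?L2norm_ge0.
  rewrite -lee_fin EFinM (le_trans (L2inner_Linf_L1 Cn0 f0 (CT f)))//.
  by rewrite lee_wpmul2l ?lee_fin// fE; exact: bump_integral.
have nE := L2norm_sqr f.
have n0 : 0 < L2norm f.
  rewrite lt_neqAle L2norm_ge0 andbT eq_sym; apply/eqP => nf0.
  by move: N2; rewrite -nE nf0 expr0n leNgt divr_gt0// mulr_gt0.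
have key : expR (- (L / 4)) * L2norm f <= C * (D / r).
  rewrite -(ler_pM2r n0) -mulrA -expr2 nE (le_trans lower)// (le_trans upper)//.
  by rewrite mulrAC.
(* Squared, so that the lower bound on |f|^2 can be inserted without square roots. *)
have key2 : expR (- (L / 2)) * L2inner f f <= C ^+ 2 * D ^+ 2 / r ^+ 2.
  have -> : expR (- (L / 2)) = expR (- (L / 4)) ^+ 2.
    by rewrite -expRM_natl; congr expR; field.
  have -> : C ^+ 2 * D ^+ 2 / r ^+ 2 = (C * (D / r)) ^+ 2.
    by field; rewrite gt_eqF.
  have l0 : 0 <= expR (- (L / 4)) * L2norm f by rewrite mulr_ge0 ?expR_ge0 ?L2norm_ge0.
  by rewrite -nE -exprMn lerXn2r// nnegrE (le_trans l0).
have key3 : expR (- (L / 2)) * (A / (r * L)) <= C ^+ 2 * D ^+ 2 / r ^+ 2.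
  by apply: le_trans key2; rewrite ler_pM2l ?expR_gt0.
have key4 : expR (L / 2) * A <= 2 * (C ^+ 2 * D ^+ 2) * L.
  have e0 : 0 < expR (L / 2) by exact: expR_gt0.
  have rE : r = expR (L / 2) ^+ 2 / 2.
    by rewrite /r -expRM_natl; congr (expR _ / _); field.
  have k0 : 0 < expR (L / 2) ^+ 4 * L / 2 by rewrite divr_gt0// mulr_gt0// exprn_gt0.
  move: key3; rewrite -(ler_pM2r k0) expRN rE; congr (_ <= _).
    by field; rewrite !gt_eqF.
  by field; rewrite gt_eqF.
(* The quadratic term of the exponential suffices, because the right side of [key4] is only linear
   in L. *)
have e8 : L ^+ 2 / 8 <= expR (L / 2).
  have L20 : 0 <= L / 2 by rewrite divr_ge0// ltW.
  have := expR_ge1Dxn 1 L20; rewrite expr_div_n (_ : 2`! = 2%N)//.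
  rewrite -mulrA -invfM (_ : 2 ^+ 2 * 2 = 8); last by ring.
  lra.
have : L ^+ 2 / 8 * A <= 2 * (C ^+ 2 * D ^+ 2) * L.
  by rewrite (le_trans _ key4)// ler_pM2r.
have LA : L * A = 16 * (C ^+ 2 * D ^+ 2) + (16 + 4 * pi) * A.
  by rewrite /L mulrDl divfK ?gt_eqF.
rewrite leNgt => /negP; apply.
rewrite (_ : L ^+ 2 / 8 * A = L * (L * A) / 8); last by ring.
rewrite LA (_ : _ / 8 = 2 * (C ^+ 2 * D ^+ 2) * L + L * ((16 + 4 * pi) * A) / 8);
  last by field.
by rewrite ltrDl divr_gt0// !mulr_gt0//; lra.
Qed.
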